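(* Let $W$ be an $n$-dimensional vector space over $\mathbb{F}_q$ with a flag $\mathcal{F}$, let $G_1,G_2$ be subgroups of the parabolic subgroup $P_{\mathcal{F}}\leq\mathrm{GL}(W)$, let $W_1=W_2=W$ and $V=W_1\oplus W_2$, and let $G_1\times_{\mathcal{F}}G_2$ be the parabolic gluing. Suppose $\mathbb{F}_q(W_1)^{G_1}=\mathbb{F}_q(f_1,\ldots,f_n)$ where $f_1,\ldots,f_n$ is a sequence of homogeneous polynomials in $\mathbb{F}_q[W_1]$ consistent with $\mathcal{F}$. Then $\mathbb{F}_q(V)^{G_1\times_{\mathcal{F}}G_2}$ is the subfield of $\mathbb{F}_q(V)$ generated by $\widetilde{f_1},\ldots,\widetilde{f_n}$ and $\mathbb{F}_q(W_2)^{G_2}$.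
   Context: For a representation $U$ of a group $H$ over $\mathbb{F}_q$, $\mathbb{F}_q[U]$ is the symmetric algebra on $U^*$, with right $H$-action induced by $(\phi\cdot h)(u)=\phi(hu)$; $\mathbb{F}_q(U)$ is its field of fractions, and $\mathbb{F}_q(U)^H$ the invariant subfield. The flag is $\mathcal{F}=(F_0(W)=\{0\},F_1(W),\ldots,F_\ell(W)=W)$ with $F_i(W)$ a proper subspace of $F_{i+1}(W)$. $P_{\mathcal{F}}$ is the group of $g\in\mathrm{GL}(W)$ stabilising every $F_i(W)$, and $\mathcal{M}_{\mathcal{F}}=\{\phi\in\mathrm{Hom}_{\mathbb{F}_q}(W,W)\mid\phi(F_i(W))\subseteq F_i(W)\text{ for }i=1,\ldots,\ell\}$. The parabolic gluing $G_1\times_{\mathcal{F}}G_2$ is the group of triples $(g_1,\varphi,g_2)\in G_1\times\mathcal{M}_{\mathcal{F}}\times G_2$ with product $(g_1,\varphi,g_2)(g_1',\varphi',g_2')=(g_1g_1',g_1\varphi'+\varphi g_2',g_2g_2')$, acting on $V=W_1\oplus W_2$ by $(g_1,\varphi,g_2)(w_1\oplus w_2)=(g_1w_1+\varphi(w_2))\oplus g_2w_2$. Let $n_i=\dim(F_i(W)/F_{i-1}(W))$ and $r_k=n_1+\cdots+n_k$ ($r_0=0$). Choose a basis of $W$ consistent with the flag (the first $r_i$ vectors span $F_i(W)$ for every $i$); let $y_1,\ldots,y_n$ be the dual basis of $W_1^*$ and $x_1,\ldots,x_n$ the dual basis of $W_2^*$, so $\mathbb{F}_q[V]=\mathbb{F}_q[y_1,\ldots,y_n,x_1,\ldots,x_n]$.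 Let $\widetilde{U}_i=\mathrm{Span}_{\mathbb{F}_q}\{x_{r_{i-1}+1},\ldots,x_n\}$ and $N_i(t):=\prod_{u\in\widetilde{U}_i}(t+u)$. A sequence of homogeneous polynomials $f_1,\ldots,f_n\in\mathbb{F}_q[W_1]$ is consistent with $\mathcal{F}$ if $f_j\in\mathbb{F}_q[y_{r_i+1},\ldots,y_n]$ whenever $r_i<j\leq r_{i+1}$; in that case $\widetilde{f_j}$ is the polynomial obtained by substituting $N_{i+1}(y_k)$ for $y_k$ in $f_j$, for all $k>r_i$. *)

(* Defs.v *)
From HB Require Import structures.
From mathcomp Require Import all_boot all_order all_algebra.
From mathcomp Require Export fraction mpoly.

Set Implicit Arguments.
Unset Strict Implicit.
Unset Printing Implicit Defensive.

Import GRing.Theory.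
Local Open Scope ring_scope.

Section SubfieldGenerated.
Variable K : fieldType.

Definition is_subfield (S : K -> Prop) : Prop :=
  [/\ S 1, forall x y, S x -> S y -> S (x - y)
         & forall x y, S x -> S y -> S (x / y)].

Definition gen_subfield (A : K -> Prop) (z : K) : Prop :=
  forall S : K -> Prop,
    is_subfield S -> (forall x, A x -> S x) -> S z.

End SubfieldGenerated.

(* The map induced on fraction fields by a ring morphism phi.  It is meant for
   injective phi only: then it does not depend on the representative of z. *)
Definition frac_map (A B : idomainType) (phi : A -> B)
    (z : {fraction A}) : {fraction B} :=
  tofrac (phi \n_(repr z)) / tofrac (phi \d_(repr z)).

Lemma tofrac_div (A : idomainType) (z : {fraction A}) :
  z = tofrac \n_(repr z) / tofrac \d_(repr z).
Proof.
rewrite -[LHS]reprK; move: (repr z) => r.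
have d0 := denom_ratioP r.
apply: (canRL (mulfK _)); first by rewrite tofrac_eq0.
unlock FracField.tofrac; rewrite -[LHS]FracField.pi_mul.
apply/eqP; rewrite FracField.equivf_def /FracField.mulf.
by rewrite !numden_Ratio ?mulf_neq0 ?oner_neq0 // !mulr1 mulrC.
Qed.

Lemma frac_mapE (A B : idomainType) (phi : {rmorphism A -> B})
    (a b : A) : injective phi -> b != 0 ->
  frac_map phi (tofrac a / tofrac b) = tofrac (phi a) / tofrac (phi b).
Proof.
move=> phi_inj b0; rewrite /frac_map; set z := tofrac a / tofrac b.
have d0 := denom_ratioP (repr z).
have nz c : c != 0 -> tofrac (phi c) != 0.
  by rewrite tofrac_eq0; apply: contra_neq => pc0; apply: phi_inj; rewrite pc0 rmorph0.
apply/eqP; rewrite eqr_div ?nz // -!tofracM -!rmorphM tofrac_eq; apply/eqP; congr (phi _).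
apply/eqP; rewrite -tofrac_eq !tofracM -eqr_div ?tofrac_eq0 //.
by rewrite -tofrac_div.
Qed.

(* F[U] is presented as {mpoly F[m]}, where 'X_i stands for the i-th element
   coord b i of the basis of U^* dual to the basis b of U. *)
Section Representation.
Variables (F : fieldType) (U : vectType F) (m : nat) (b : m.-tuple U).

(* The linear form u |-> coord b i (h u), expressed in the dual basis. *)
Definition pullback (h : U -> U) (i : 'I_m) : {mpoly F[m]} :=
  \sum_(j < m) coord b i (h b`_j) *: 'X_j.

Definition poly_act (h : U -> U) (p : {mpoly F[m]}) : {mpoly F[m]} :=
  p \mPo [tuple pullback h i | i < m].

Definition frac_act (h : U -> U) : {fraction {mpoly F[m]}} ->
    {fraction {mpoly F[m]}} :=
  frac_map (poly_act h).

(* F(U)^H, where the elements of the group H are those of a type T satisfying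
   H, and t : T acts on U by rho t. *)
Definition inv_field (T : Type) (H : T -> Prop) (rho : T -> U -> U)
    (z : {fraction {mpoly F[m]}}) : Prop :=
  forall t : T, H t -> frac_act (rho t) z = z.

End Representation.

Section Flag.
Variables (F : fieldType) (W : vectType F) (l : nat) (Fl : nat -> {vspace W}).

(* Only the values Fl 0, ..., Fl l are relevant. *)
Definition is_flag : Prop :=
  [/\ Fl 0%N = 0%VS, Fl l = fullv
    & forall i, (i < l)%N -> (Fl i <= Fl i.+1)%VS /\ Fl i <> Fl i.+1].

Definition flag_gap (i : nat) : nat := (\dim (Fl i) - \dim (Fl i.-1))%N.

Definition flag_rank (k : nat) : nat := (\sum_(1 <= i < k.+1) flag_gap i)%N.

Definition in_block (i j : nat) : bool :=
  [&& (i < l)%N, (flag_rank i <= j)%N & (j < flag_rank i.+1)%N].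

Definition flag_basis (n : nat) (e : n.-tuple W) : Prop :=
  basis_of fullv e /\
  forall i, (i <= l)%N -> <<take (flag_rank i) e>>%VS = Fl i.

Definition is_GL_subgroup (G : {pred 'End(W)}) : Prop :=
  [/\ {subset G <= [pred g : 'End(W) | lker g == 0%VS]}, \1%VF \in G,
      {in G &, forall g h : 'End(W), (g \o h)%VF \in G}
    & {in G, forall g : 'End(W), (g^-1)%VF \in G}].

Definition parabolic : {pred 'End(W)} :=
  [pred g : 'End(W) | (lker g == 0%VS) &&
     [forall i : 'I_l.+1, (g @: Fl i)%VS == Fl i]].

Definition flag_endo : {pred 'End(W)} :=
  [pred phi : 'End(W) | [forall i : 'I_l, (phi @: Fl i.+1 <= Fl i.+1)%VS]].

Hypothesis fl : is_flag.

Lemma flag_rankE k : (k <= l)%N -> flag_rank k = \dim (Fl k).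
Proof.
have [F0 _ F_sub] := fl.
elim: k => [|k IHk] lekl; first by rewrite /flag_rank big_geq // F0 dimv0.
have -> : flag_rank k.+1 = (flag_rank k + flag_gap k.+1)%N.
  by rewrite /flag_rank big_nat_recr.
rewrite IHk; last exact: ltnW.
by rewrite /flag_gap /= subnKC // dimvS //; case: (F_sub k lekl).
Qed.

Lemma in_block_ex (j : nat) : (j < \dim {:W})%N -> exists i, in_block i j.
Proof.
have [_ Fll _] := fl; rewrite -Fll -flag_rankE //.
rewrite /in_block; elim: (l) => [|k IHk]; first by rewrite /flag_rank big_geq.
have [/IHk[i /andP[/ltnW ik ?]] _ | rk_j j_rk] := ltnP j (flag_rank k).
  by exists i; rewrite ltnS ik.
by exists k; rewrite ltnSn rk_j.
Qed.

Lemma in_block_inj (i i' j : nat) :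
  in_block i j -> in_block i' j -> i = i'.
Proof.
have mono a b : (a <= b)%N -> (flag_rank a <= flag_rank b)%N.
  by move=> ab; rewrite /flag_rank (@big_cat_nat _ _ _ a.+1 1 b.+1) //= leq_addr.
case/and3P=> _ ri rSi /and3P[_ ri' rSi']; apply/eqP; rewrite eqn_leq.
apply/andP; split; rewrite leqNgt; apply/negP => /mono.
  by rewrite leqNgt (leq_ltn_trans ri).
by rewrite leqNgt (leq_ltn_trans ri').
Qed.

End Flag.

Section Gluing.
Variables (F : fieldType) (W : vectType F) (l : nat) (Fl : nat -> {vspace W}).
Variables G1 G2 : {pred 'End(W)}.

(* (g1, phi, g2) parses as ((g1, phi), g2). *)
Definition glue_triple : Type := ('End(W) * 'End(W) * 'End(W))%type.

Definition gluing (t : glue_triple) : Prop :=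
  [/\ t.1.1 \in G1, t.1.2 \in flag_endo l Fl & t.2 \in G2].

Definition glue_one : glue_triple := (\1%VF, 0, \1%VF).

Definition glue_mul (s t : glue_triple) : glue_triple :=
  ((s.1.1 \o t.1.1)%VF, (s.1.1 \o t.1.2)%VF + (s.1.2 \o t.2)%VF,
   (s.2 \o t.2)%VF).

Definition glue_inv (t : glue_triple) : glue_triple :=
  ((t.1.1^-1)%VF, - (t.1.1^-1 \o t.1.2 \o t.2^-1)%VF, (t.2^-1)%VF).

Definition glue_act (t : glue_triple) (w : W * W) : W * W :=
  (t.1.1 w.1 + t.1.2 w.2, t.2 w.2).

Definition glue_basis (n : nat) (e : n.-tuple W) : (n + n).-tuple (W * W)%type :=
  [tuple of [seq (w, 0 : W) | w <- e] ++ [seq (0 : W, w) | w <- e]].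

Lemma glue_act1 : glue_act glue_one =1 id.
Proof. by case=> u v; rewrite /glue_act /= !id_lfunE zero_lfunE addr0. Qed.

Lemma glue_actM s t w :
  glue_act (glue_mul s t) w = glue_act s (glue_act t w).
Proof.
by rewrite /glue_act /= !add_lfunE !comp_lfunE linearD addrA.
Qed.

Hypotheses (subG1 : is_GL_subgroup G1) (subG2 : is_GL_subgroup G2).
Hypotheses (parG1 : {subset G1 <= parabolic l Fl}).
Hypotheses (parG2 : {subset G2 <= parabolic l Fl}).

Lemma flag_endo_comp f g : f \in flag_endo l Fl -> g \in flag_endo l Fl ->
  (f \o g)%VF \in flag_endo l Fl.
Proof.
move=> /forallP hf /forallP hg; apply/forallP => i.
by rewrite limg_comp (subv_trans (limgS f (hg i))) ?hf.
Qed.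

Lemma parabolic_endo g : g \in parabolic l Fl -> g \in flag_endo l Fl.
Proof.
case/andP=> _ /forallP hg; apply/forallP => i.
by have /eqP-> := hg (lift ord0 i).
Qed.

Lemma flag_endo_add f g : f \in flag_endo l Fl -> g \in flag_endo l Fl ->
  f + g \in flag_endo l Fl.
Proof.
move=> /forallP hf /forallP hg; apply/forallP => i; apply/subvP => _ /memv_imgP[u ui ->].
rewrite add_lfunE memvD //.
  by apply: (subvP (hf i)); apply: memv_img.
by apply: (subvP (hg i)); apply: memv_img.
Qed.

Lemma flag_endo_opp f : f \in flag_endo l Fl -> - f \in flag_endo l Fl.
Proof.
move=> /forallP hf; apply/forallP => i; apply/subvP => _ /memv_imgP[u ui ->].
by rewrite opp_lfunE memvN; apply: (subvP (hf i)); apply: memv_img.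
Qed.

Lemma gluing1 : gluing glue_one.
Proof.
have [_ G1_1 _ _] := subG1; have [_ G2_1 _ _] := subG2; split=> //=.
by apply/forallP => i; rewrite lim0g sub0v.
Qed.

Lemma gluingM s t : gluing s -> gluing t -> gluing (glue_mul s t).
Proof.
have [_ _ M1 _] := subG1; have [_ _ M2 _] := subG2.
case=> s1 s2 s3 [t1 t2 t3]; split; rewrite /= ?M1 ?M2 //.
apply: flag_endo_add; apply: flag_endo_comp => //; apply: parabolic_endo.
  by rewrite parG1.
by rewrite parG2.
Qed.

Lemma gluingV t : gluing t -> gluing (glue_inv t).
Proof.
have [_ _ _ V1] := subG1; have [_ _ _ V2] := subG2.
case=> t1 t2 t3; split; rewrite /= ?V1 ?V2 //.
apply: flag_endo_opp; apply: flag_endo_comp; last first.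
  by apply: parabolic_endo; rewrite parG2 ?V2.
apply: flag_endo_comp => //.
by apply: parabolic_endo; rewrite parG1 ?V1.
Qed.

Lemma glue_mulV t : gluing t -> glue_mul (glue_inv t) t = glue_one.
Proof.
have [k1 _ _ _] := subG1; have [k2 _ _ _] := subG2.
case: t => [[g phi] h] [/= /k1 g_inj _ /k2 h_inj].
rewrite /glue_mul /glue_one /= !lker0_compVf //.
congr (_, _, _); apply/lfunP => u.
rewrite !add_lfunE !comp_lfunE opp_lfunE zero_lfunE !comp_lfunE /=.
by rewrite lker0_lfunK // subrr.
Qed.

Lemma glue_basisP n (e : n.-tuple W) :
  basis_of fullv e -> basis_of fullv (glue_basis e).
Proof.
move=> e_basis.
have sze : \dim {:W} = n.
  by have := span_basis e_basis; have := basis_free e_basis => /eqP + <- => ->; rewrite size_tuple.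
rewrite basisEdim size_tuple; apply/andP; split; last first.
  have dimE (U : vectType F) : \dim {:U} = dim U by rewrite dimvf.
  by rewrite dimE -[dim _]/(dim W + dim W)%N -!dimE sze.
apply/subvP => -[u v] _.
have -> : (u, v) = \sum_(i < n) coord e i u *: (e`_i, 0 : W)
                 + \sum_(i < n) coord e i v *: (0 : W, e`_i).
  have pair1 : u = \sum_(i < n) coord e i u *: e`_i.
    exact: coord_basis e_basis (memvf u).
  have pair2 : v = \sum_(i < n) coord e i v *: e`_i.
    exact: coord_basis e_basis (memvf v).
  apply: injective_projections => /=.
    rewrite !raddf_sum /= [X in _ = _ + X]big1 ?addr0 // => i _.
    by rewrite scaler0.
  rewrite !raddf_sum /= [X in _ = X + _]big1 ?add0r // => i _.
  by rewrite scaler0.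
have e_nth i : (i < n)%N -> e`_i \in (e : seq W).
  by move=> hi; rewrite mem_nth ?size_tuple.
apply: memvD; apply: memv_suml => i _; apply/memvZ/memv_span; rewrite mem_cat.
  by apply/orP; left; apply/mapP; exists e`_i; rewrite ?e_nth.
by apply/orP; right; apply/mapP; exists e`_i; rewrite ?e_nth.
Qed.

End Gluing.

(* In F[V] = {mpoly F[n + n]} the first n variables are the y's (dual to the
   basis of W_1) and the last n ones are the x's (dual to that of W_2).  All
   variables are numbered from 0. *)
Section GluingPolynomials.
Variables (F : finFieldType) (n : nat).
Variables (W : vectType F) (l : nat) (Fl : nat -> {vspace W}).

Definition yvar (k : 'I_n) : {mpoly F[n + n]} := 'X_(lshift n k).
Definition xvar (k : 'I_n) : {mpoly F[n + n]} := 'X_(rshift n k).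

(* F(W_2) as a subfield of F(V). *)
Definition embed2 :
    {fraction {mpoly F[n]}} -> {fraction {mpoly F[n + n]}} :=
  frac_map (fun p : {mpoly F[n]} => p \mPo [tuple xvar k | k < n]).

(* The coefficient vectors, in the basis of the x's, of the elements of
   U~_i = Span {x_k | r_(i-1) <= k < n}. *)
Definition Utilde (i : nat) : {set {ffun 'I_n -> F}} :=
  [set c : {ffun 'I_n -> F} | [forall k : 'I_n, (k < flag_rank Fl i.-1)%N ==> (c k == 0)]].

Definition Npoly (i : nat) (t : {mpoly F[n + n]}) : {mpoly F[n + n]} :=
  \prod_(c : {ffun 'I_n -> F} | c \in Utilde i) (t + \sum_(k < n) c k *: xvar k).

(* p is a polynomial in the variables of index at least r only. *)
Definition mpoly_from (r : nat) (p : {mpoly F[n]}) : Prop :=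
  forall m : 'X_{1..n}, m \in msupp p ->
  forall k : 'I_n, (k < r)%N -> m k = 0%N.

Definition homogeneous (p : {mpoly F[n]}) : Prop :=
  exists d : nat, p \is d.-homog.

Definition flag_consistent (f : 'I_n -> {mpoly F[n]}) : Prop :=
  forall i (j : 'I_n), in_block l Fl i j -> mpoly_from (flag_rank Fl i) (f j).

Definition tilde_at (i : nat) (p : {mpoly F[n]}) : {mpoly F[n + n]} :=
  p \mPo [tuple if (flag_rank Fl i <= k)%N then Npoly i.+1 (yvar k)
                else yvar k | k < n].

(* p is f_j~: for each j there is exactly one i with in_block l Fl i j. *)
Definition is_tilde (f : 'I_n -> {mpoly F[n]}) (j : 'I_n)
    (p : {mpoly F[n + n]}) : Prop :=
  exists2 i, in_block l Fl i j & p = tilde_at i (f j).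

End GluingPolynomials.

(* Main.v *)
From HB Require Import structures.
Require Import Defs.
From mathcomp Require Import all_boot all_order all_algebra all_fingroup finfield.
From mathcomp Require Import boolp.
From mathcomp Require Import fraction mpoly.

Set Implicit Arguments.
Unset Strict Implicit.
Unset Printing Implicit Defensive.

Import GRing.Theory.
Local Open Scope ring_scope.

(* For i = l, ..., 0 let L_i = F(x, y_k : k >= r_i), so that L_l = F(W_2) and
   L_0 = F(V), and let G be the glued group.  It suffices to show
   L_i^G <= L_(i+1)(f~_j : j in block i): if R is a G-stable field and S consists
   of invariants, then R(S)^G = R^G(S) by a trace argument, so one can descend
   from L_0 to L_l, where L_l^G = F(W_2)^(G_2).

   An element of L_i^G is invariant under the translations y_k -> y_k + u, u in
   U~_(i+1), of the block, hence lies in L_(i+1)(N(y_k) : k in block i) with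
   N = N_(i+1).  As N is F-linear and kills U~_(i+1), the group acts on the N(y_k),
   k >= r_i, as G_1 acts on the y_k, and Galois descent reduces the claim to
   F(y_k : k >= r_i)^(G_1) = F(f_j : j >= r_i).  This last equality holds because
   f_1, ..., f_n generate a field over which the n variables are algebraic, so
   that no f_j is algebraic over the other f's and the y_k with k >= r_i > j. *)

(** * Subfields of a field *)

(** The spaces U~_(i+1) come from M_F: in a basis adapted to the flag, phi is block upper
    triangular, so for k >= r_i it adds to y_k a form of U~_(i+1). For k in block i, maps of rank
    one realise every such form while moving y_k alone, which is why N(y_k) can replace y_k one
    variable at a time. The obstacle in the Galois step is that L_(i+1) and F(N(y_k) : k >= r_i)
    overlap: both contain the N(y_k) with k >= r_(i+1). Invariants are therefore compared through
    pointwise stabilizers: an element g of G_1 that fixes y_k for k >= r_(i+1) lifts to (g, 0, 1),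
    which fixes all of L_(i+1). *)

Section Subrings.
Variable L : fieldType.
Implicit Types (S A B : L -> Prop).

Definition is_subring S : Prop :=
  [/\ S 1, forall x y, S x -> S y -> S (x - y)
         & forall x y, S x -> S y -> S (x * y)].

Lemma is_subfield_subring S : is_subfield S -> is_subring S.
Proof.
case=> S1 SB SD; split=> // x y Sx Sy.
by rewrite -[y]invrK; apply: (SD) => //; rewrite -[y^-1]mul1r; apply: (SD).
Qed.

Section SubringTheory.
Variable S : L -> Prop.
Hypothesis subS : is_subring S.

Lemma subring1 : S 1. Proof. by case: subS. Qed.
Lemma subringB x y : S x -> S y -> S (x - y).
Proof. by case: subS => _ + _; apply. Qed.
Lemma subringM x y : S x -> S y -> S (x * y).
Proof. by case: subS => _ _; apply. Qed.
Lemma subring0 : S 0.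
Proof. by rewrite -(subrr 1); apply: subringB; apply: subring1. Qed.
Lemma subringN x : S x -> S (- x).
Proof. by rewrite -sub0r; apply: subringB; apply: subring0. Qed.
Lemma subringD x y : S x -> S y -> S (x + y).
Proof. by move=> Sx Sy; rewrite -[y]opprK; apply/subringB/subringN. Qed.
Lemma subringX x k : S x -> S (x ^+ k).
Proof.
move=> Sx; elim: k => [|k IH]; rewrite ?expr0 ?exprS; first exact: subring1.
exact: subringM.
Qed.
Lemma subring_sum (I : Type) (r : seq I) (P : pred I) (E : I -> L) :
  (forall i, P i -> S (E i)) -> S (\sum_(i <- r | P i) E i).
Proof. by move=> SE; elim/big_ind: _ => //; [apply: subring0|apply: subringD]. Qed.
Lemma subring_prod (I : Type) (r : seq I) (P : pred I) (E : I -> L) :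
  (forall i, P i -> S (E i)) -> S (\prod_(i <- r | P i) E i).
Proof. by move=> SE; elim/big_ind: _ => //; [apply: subring1|apply: subringM]. Qed.

End SubringTheory.

Lemma subring_subfield S : is_subring S ->
  (forall x, S x -> S x^-1) -> is_subfield S.
Proof.
move=> subS SV; split; [exact: subring1 | by apply: subringB |].
by move=> x y Sx Sy; apply: subringM => //; apply: SV.
Qed.

Lemma subfieldV S x : is_subfield S -> S x -> S x^-1.
Proof. by move=> [S1 _ SD] Sx; rewrite -[x^-1]mul1r; apply: SD. Qed.

Lemma gen_subfieldP A : is_subfield (gen_subfield A).
Proof.
split=> [S [] //|x y Sx Sy S sS AS|x y Sx Sy S sS AS].
  by case: (sS) => _ + _; apply; [apply: Sx|apply: Sy].
by case: (sS) => _ _; apply; [apply: Sx|apply: Sy].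
Qed.

Lemma gen_subring A : is_subring (gen_subfield A).
Proof. exact/is_subfield_subring/gen_subfieldP. Qed.

Lemma mem_gen A x : A x -> gen_subfield A x.
Proof. by move=> Ax S _; apply. Qed.

Lemma gen_min A S : is_subfield S -> (forall x, A x -> S x) ->
  forall x, gen_subfield A x -> S x.
Proof. by move=> sS AS x; apply. Qed.

Lemma gen_mono A B : (forall x, A x -> gen_subfield B x) ->
  forall x, gen_subfield A x -> gen_subfield B x.
Proof. exact: gen_min (gen_subfieldP B). Qed.

End Subrings.

Arguments mem_gen {L A x} _.
(* It unfolds to a product, which [apply:] would otherwise open. *)
#[local] Opaque gen_subfield.
#[local] Hint Resolve gen_subfieldP gen_subring is_subfield_subring : core.

Lemma is_subfield_preim (L M : fieldType) (h : {rmorphism L -> M}) T :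
  is_subfield T -> is_subfield (fun z => T (h z)).
Proof.
case=> T1 TB TD; split=> [|x y|x y]; rewrite ?rmorph1 ?rmorphB ?fmorph_div //.
  exact: TB.
exact: TD.
Qed.

Lemma is_subfield_im (L M : fieldType) (h : {rmorphism L -> M}) S :
  is_subfield S -> is_subfield (fun w => exists2 z, S z & w = h z).
Proof.
case=> S1 SB SD; split=> [|_ _ [x Sx ->] [y Sy ->]|_ _ [x Sx ->] [y Sy ->]].
- by exists 1; rewrite ?rmorph1.
- by exists (x - y); [apply: SB|rewrite rmorphB].
- by exists (x / y); [apply: SD|rewrite fmorph_div].
Qed.

Lemma gen_rmorph (L M : fieldType) (h : {rmorphism L -> M}) A T :
    is_subfield T -> (forall x, A x -> T (h x)) ->
  forall z, gen_subfield A z -> T (h z).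
Proof.
move=> sT AT; apply: (gen_min (S := fun z => T (h z))) => //.
exact: is_subfield_preim.
Qed.

Lemma gen_rmorph_eq (L M : fieldType) (h k : {rmorphism L -> M}) A :
    (forall x, A x -> h x = k x) ->
  forall z, gen_subfield A z -> h z = k z.
Proof.
move=> hk z; apply: (gen_min (S := fun z => h z = k z)) => //.
split=> [|x y hx hy|x y hx hy]; first by rewrite !rmorph1.
  by rewrite !rmorphB hx hy.
by rewrite !fmorph_div hx hy.
Qed.

(** * Subfields as field types *)

Section SubfieldType.
Variables (L : fieldType) (S : L -> Prop) (subS : is_subfield S).

Definition sfpred : {pred L} := fun x => `[< S x >].

Lemma sfpredP x : reflect (S x) (x \in sfpred).
Proof. exact: asboolP. Qed.

Fact sfpred_closed : divring_closed sfpred.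
Proof.
case: subS => S1 SB SD.
split=> [|x y|x y]; first exact/sfpredP.
  by move=> /sfpredP ? /sfpredP ?; apply/sfpredP/SB.
by move=> /sfpredP ? /sfpredP ?; apply/sfpredP/SD.
Qed.

(** The argument records the closure proof in the term, so that instance resolution recovers the
    field structure from [sfkey subS]. *)
Definition sfkey (_ : is_subfield S) : {pred L} := sfpred.
HB.instance Definition _ :=
  GRing.isDivringClosed.Build L (sfkey subS) sfpred_closed.

Definition sftype := {x : L | x \in sfkey subS}.
HB.instance Definition _ := SubType.on sftype.
HB.instance Definition _ := Choice.on sftype.
HB.instance Definition _ := [SubChoice_isSubIntegralDomain of sftype by <:].
HB.instance Definition _ := [SubIntegralDomain_isSubField of sftype by <:].

End SubfieldType.

(** * Algebraic dependence over a subfield *)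

Section AlgebraicClosure.
Variable L : fieldType.
Implicit Types (S E : L -> Prop) (p q : {poly L}).

Definition coefs_in S p := forall i, S p`_i.

Definition algebraic_over S x :=
  exists p, [/\ p != 0, coefs_in S p & root p x].

Definition adjoin S (s : seq L) := gen_subfield (fun u => S u \/ u \in s).

Lemma coefs_in_lift S (subS : is_subfield S) p : coefs_in S p ->
  exists q : {poly sftype subS}, p = map_poly \val q.
Proof.
move=> Sp; exists (map_poly (insubd (0 : sftype subS)) p).
apply/polyP => i; rewrite coef_map coef_map_id0.
  by rewrite /= val_insubd; case: ifP => // /sfpredP[].
by apply: val_inj; rewrite val_insubd; case: ifP.
Qed.

Lemma coefs_in_val S (subS : is_subfield S) (q : {poly sftype subS}) :
  coefs_in S (map_poly \val q).
Proof. by move=> i; rewrite coef_map; apply/sfpredP; apply: valP. Qed.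

(** Over a field, algebraic and integral agree; in the integral form, closure under field operations
    and transitivity are available. *)
Lemma algebraic_overP S (subS : is_subfield S) x :
  algebraic_over S x <-> integralOver (\val : sftype subS -> L) x.
Proof.
rewrite -integral_algebraic; split=> [[p [p0 Sp px]]|[q q0 qx]].
  have [q Dp] := coefs_in_lift subS Sp; exists q; rewrite -?Dp //.
  by apply: contra_neq p0 => q0; rewrite Dp q0 rmorph0.
exists (map_poly \val q); split=> //; last exact: coefs_in_val.
by rewrite map_poly_eq0.
Qed.

Lemma algebraic_over_subfield S : is_subfield S -> is_subfield (algebraic_over S).
Proof.
move=> subS; split=> [|x y|x y]; rewrite !(algebraic_overP subS).
- exact: integral1.
- exact: integral_sub.
- exact: integral_div.
Qed.

Lemma algebraic_over_self S x : is_subfield S -> S x -> algebraic_over S x.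
Proof.
move=> /is_subfield_subring subS Sx; exists ('X - x%:P); split.
- by rewrite polyXsubC_eq0.
- move=> i; rewrite coefB coefX coefC; apply: subringB => //; case: eqP => // _.
  + exact: subring1.
  + exact: subring0.
  + exact: subring0.
- by rewrite root_XsubC.
Qed.

Lemma algebraic_over_trans S T x : is_subfield S ->
    (forall y, T y -> algebraic_over S y) ->
  algebraic_over T x -> algebraic_over S x.
Proof.
move=> subS TS [p [p0 Tp px]]; apply/(algebraic_overP subS).
by apply: integral_root p0 px _ => _ /(nthP 0)[i _ <-]; apply/algebraic_overP/TS.
Qed.

Lemma horner_in S p x : is_subring S -> coefs_in S p -> S x -> S p.[x].
Proof.
move=> subS Sp Sx; rewrite horner_coef; apply: subring_sum => // i _.
by apply: subringM => //; apply: subringX.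
Qed.

Section CoefsIn.
Variable S : L -> Prop.
Hypothesis subS : is_subring S.

Lemma coefs_in1 : coefs_in S 1.
Proof.
by move=> i; rewrite coef1; case: eqP => _; [apply: subring1|apply: subring0].
Qed.
Lemma coefs_inB p q : coefs_in S p -> coefs_in S q -> coefs_in S (p - q).
Proof. by move=> Sp Sq i; rewrite coefB; apply: subringB. Qed.
Lemma coefs_inM p q : coefs_in S p -> coefs_in S q -> coefs_in S (p * q).
Proof.
move=> Sp Sq i; rewrite coefM; apply: subring_sum => // j _.
exact: subringM.
Qed.
Lemma coefs_inC x : S x -> coefs_in S x%:P.
Proof. by move=> Sx i; rewrite coefC; case: eqP => // _; apply: subring0. Qed.
Lemma coefs_inX : coefs_in S 'X.
Proof.
by move=> i; rewrite coefX; case: eqP => _; [apply: subring1|apply: subring0].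
Qed.
Lemma coefs_in_prod (I : Type) (r : seq I) (P : pred I) (E : I -> {poly L}) :
  (forall i, P i -> coefs_in S (E i)) -> coefs_in S (\prod_(i <- r | P i) E i).
Proof. by move=> SE; elim/big_ind: _ => //; [apply: coefs_in1|apply: coefs_inM]. Qed.
End CoefsIn.

(** The Euclidean division is carried out over [S] itself, so the remainder keeps its coefficients
    there. *)
Lemma coefs_in_mod S p q y : is_subfield S -> coefs_in S p -> coefs_in S q ->
    q != 0 -> root q y ->
  exists g, [/\ coefs_in S g, (size g < size q)%N & g.[y] = p.[y]].
Proof.
move=> subS Sp Sq; have [p' ->] := coefs_in_lift subS Sp.
have [q' ->] := coefs_in_lift subS Sq => q0 /eqP qy.
exists (map_poly \val (p' %% q')); split; first exact: coefs_in_val.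
  by rewrite !size_map_poly ltn_modp; apply: contra_neq q0 => ->; rewrite rmorph0.
by rewrite [in RHS](divp_eq p' q') rmorphD rmorphM !hornerE qy mulr0 add0r.
Qed.

Lemma adjoin1P E g z : is_subfield E -> adjoin E [:: g] z ->
  exists p q, [/\ coefs_in E p, coefs_in E q, q.[g] != 0 & z = p.[g] / q.[g]].
Proof.
move=> sE; have rE := is_subfield_subring sE.
pose T z := exists p q,
  [/\ coefs_in E p, coefs_in E q, q.[g] != 0 & z = p.[g] / q.[g]].
apply: (gen_min (S := T)) => [|u [Eu|]]; last 2 first.
- exists u%:P, 1; split; [exact: coefs_inC|exact: coefs_in1|..];
    by rewrite !hornerE ?oner_eq0 ?divr1.
- rewrite inE => /eqP->; exists 'X, 1.
  split; [exact: coefs_inX|exact: coefs_in1|..];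
    by rewrite !hornerE ?oner_eq0 ?divr1.
split=> [|_ _ [p [q [Ep Eq q0 ->]]] [p' [q' [Ep' Eq' q'0 ->]]]
         |_ _ [p [q [Ep Eq q0 ->]]] [p' [q' [Ep' Eq' q'0 ->]]]].
- exists 1, 1; split; try exact: coefs_in1; by rewrite !hornerC ?oner_eq0 ?divr1.
- exists (p * q' - p' * q), (q * q'); split.
  + by apply: coefs_inB => //; apply: coefs_inM.
  + exact: coefs_inM.
  + by rewrite hornerM mulf_neq0.
  + by rewrite !hornerE -mulNr addf_div // mulNr.
(* Division by zero yields 0, so in this case the quotient is 0 / 1. *)
- have [p'0|p'0] := eqVneq p'.[g] 0.
    exists 0, 1; split; [|exact: coefs_in1|..].
    + by move=> i; rewrite coef0; apply: subring0.
    + by rewrite hornerC oner_eq0.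
    + by rewrite p'0 mul0r invr0 mulr0 horner0 mul0r.
  exists (p * q'), (q * p'); split; try exact: coefs_inM.
  + by rewrite hornerM mulf_neq0.
  + by rewrite !hornerE invf_div mulf_div.
Qed.

Lemma adjoin_subfield E s : is_subfield (adjoin E s).
Proof. exact: gen_subfieldP. Qed.

Lemma adjoin_base E s x : E x -> adjoin E s x.
Proof. by move=> Ex; apply: mem_gen; left. Qed.

Lemma adjoin_mem E s x : x \in s -> adjoin E s x.
Proof. by move=> sx; apply: mem_gen; right. Qed.

Arguments adjoin_base {E s x} _.
Arguments adjoin_mem {E s x} _.

Lemma adjoin_min E s T : is_subfield T -> (forall x, E x -> T x) ->
  (forall x, x \in s -> T x) -> forall x, adjoin E s x -> T x.
Proof. by move=> sT ET sT' x; apply: gen_min => // u []; [apply: ET|apply: sT']. Qed.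

(* A relation sum_i r_i(g) x^i = 0 over E is read as a polynomial equation for
   g over E(x), which is nontrivial because x is transcendental over E. *)
Lemma algebraic_exchange E g x : is_subfield E ->
    algebraic_over (adjoin E [:: g]) x -> ~ algebraic_over E x ->
  algebraic_over (adjoin E [:: x]) g.
Proof.
move=> sE [P [P0 EP Px]] tx; have rE := is_subfield_subring sE.
have /choice[p /choice[q pqP]] : forall i, exists p q,
    [/\ coefs_in E p, coefs_in E q, q.[g] != 0 & P`_i = p.[g] / q.[g]].
  by move=> i; apply: adjoin1P.
pose m := size P.
pose r (i : 'I_m) := p i * \prod_(j < m | j != i) q j.
pose D := \prod_(j < m) (q j).[g].
have D0 : D != 0 by apply/prodf_neq0 => j _; case: (pqP j).
have Er i : coefs_in E (r i).
  apply: coefs_inM => //; first by case: (pqP i).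
  by apply: coefs_in_prod => // j _; case: (pqP j).
have rg i : (r i).[g] = D * P`_i.
  rewrite /D (bigD1 i) //= hornerM horner_prod; case: (pqP i) => _ _ q0 ->.
  by rewrite [RHS]mulrC mulrA divfK.
(* The same relation with the roles exchanged: the k-th coefficient of [B] is the value at x of a
   polynomial over E, whose coefficients are the k-th ones of the [r i]. *)
pose B := \sum_(i < m) x ^+ i *: r i.
have Bk k : B`_k = (\poly_(i < m) oapp (fun i => (r i)`_k) 0 (insub i)).[x].
  rewrite horner_poly coef_sum; apply: eq_bigr => i _.
  by rewrite coefZ valK /= mulrC.
exists B; split.
- apply/eqP => B0.
  have r0 i : r i = 0.
    apply/polyP => k; rewrite coef0; apply: contrapT => rik; apply: tx.
    exists (\poly_(i < m) oapp (fun i => (r i)`_k) 0 (insub i)); split.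
    + apply/eqP => /(congr1 (fun f : {poly L} => f`_i)).
      by rewrite coef0 coef_poly ltn_ord valK.
    + move=> j; rewrite coef_poly; case: ifP => [jm|_]; last exact: subring0.
      by rewrite insubT; apply: Er.
    + by rewrite /root -Bk B0 coef0.
  have m0 : (m.-1 < m)%N by rewrite ltn_predL lt0n size_poly_eq0.
  case/negP: P0; rewrite -lead_coef_eq0 lead_coefE.
  have := rg (Ordinal m0); rewrite r0 horner0 => /esym/eqP.
  by rewrite mulf_eq0 (negPf D0).
- have rA := is_subfield_subring (adjoin_subfield E [:: x]).
  move=> k; rewrite coef_sum; apply: (subring_sum rA) => i _; rewrite coefZ.
  apply: (subringM rA); last by apply: adjoin_base; apply: Er.
  by apply: (subringX rA); apply: adjoin_mem; rewrite inE.
- rewrite /root /B horner_sum (eq_bigr (fun i : 'I_m => D * (P`_i * x ^+ i))).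
    by rewrite -mulr_sumr -horner_coef (eqP Px) mulr0.
  by move=> i _; rewrite hornerZ rg mulrC mulrA.
Qed.

Fixpoint alg_independent E (s : seq L) : Prop :=
  if s is y :: s' then ~ algebraic_over E y /\ alg_independent (adjoin E [:: y]) s'
  else True.

(** Adjoin the entries of [s] one at a time: the entry at which y first becomes algebraic can be
    exchanged for y. *)
Lemma algebraic_exchange_seq s E y : is_subfield E -> ~ algebraic_over E y ->
    algebraic_over (adjoin E s) y ->
  exists s1 g s2, s = s1 ++ g :: s2 /\ algebraic_over (adjoin E (y :: s1)) g.
Proof.
elim: s E => [|g s IH] E sE ty ay.
  case: ty; apply: algebraic_over_trans ay => // u; apply: adjoin_min => //.
    exact: algebraic_over_subfield.
  by move=> x; apply: algebraic_over_self.
have [ay1|ty1] := EM (algebraic_over (adjoin E [:: g]) y).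
  by exists [::], g, s; split=> //; apply: algebraic_exchange.
have sub_alg T T' x : is_subfield T' -> (forall u, T u -> T' u) ->
    algebraic_over T x -> algebraic_over T' x.
  move=> sT' TT'; apply: algebraic_over_trans => // u /TT'.
  exact: algebraic_over_self.
have [||s1 [g' [s2 [-> ag']]]] := IH (adjoin E [:: g]) _ ty1.
- exact: adjoin_subfield.
- apply: sub_alg ay; first exact: adjoin_subfield.
  apply: adjoin_min => [|x Ex|x]; first exact: adjoin_subfield.
    by do 2!apply: adjoin_base.
  rewrite inE => /predU1P[->|xs]; last exact: adjoin_mem.
  by apply: adjoin_base; apply: adjoin_mem; rewrite mem_head.
exists (g :: s1), g', s2; split=> //.
apply: sub_alg ag'; first exact: adjoin_subfield.
apply: adjoin_min => [|x|x]; first exact: adjoin_subfield.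
  apply: adjoin_min => [|x' Ex|x']; first exact: adjoin_subfield.
    exact: adjoin_base.
  by rewrite inE => /eqP->; apply: adjoin_mem; rewrite !inE eqxx orbT.
by rewrite inE => xs; apply: adjoin_mem; rewrite !inE orbCA xs orbT.
Qed.

(** Steinitz exchange: the first y takes the place of some g in [s], and the induction continues
    over E(y) with [s] one shorter. *)
Lemma alg_independent_size E ys s : is_subfield E -> alg_independent E ys ->
    (forall y, y \in ys -> algebraic_over (adjoin E s) y) ->
  (size ys <= size s)%N.
Proof.
elim: ys s E => [|y ys IH] // s E sE [ty iys] ays.
have [|s1 [g [s2 [Ds ag]]]] := @algebraic_exchange_seq s E y sE ty _.
  by apply: ays; rewrite inE eqxx.
rewrite Ds size_cat /= addnS ltnS -size_cat.
apply: IH iys _; first exact: adjoin_subfield.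
move=> z zys; have sA : is_subfield (adjoin (adjoin E [:: y]) (s1 ++ s2)).
  exact: adjoin_subfield.
have {ays} := ays z; rewrite inE zys orbT => /(_ isT).
apply: algebraic_over_trans => // u; apply: adjoin_min => [|x Ex|x].
- exact: algebraic_over_subfield.
- exact: (algebraic_over_self sA (adjoin_base (adjoin_base Ex))).
rewrite Ds mem_cat inE orbCA -mem_cat => /predU1P[->|xs]; last first.
  exact: (algebraic_over_self sA (adjoin_mem xs)).
apply: algebraic_over_trans ag => // v Av; apply: algebraic_over_self => //.
move: v Av; apply: adjoin_min => // v.
  by move=> Ev; apply: (adjoin_base (adjoin_base Ev)).
rewrite inE => /predU1P[->|vs]; last by apply: adjoin_mem; rewrite mem_cat vs.
by apply: adjoin_base; apply: adjoin_mem; rewrite mem_head.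
Qed.

(* If z lies in E(g) and g is transcendental over a field containing E and z,
   compare coefficients in z q(g) = p(g). *)
Lemma adjoin_transcendental E T g z : is_subfield E -> is_subfield T ->
    (forall x, E x -> T x) -> ~ algebraic_over T g -> T z ->
  adjoin E [:: g] z -> E z.
Proof.
move=> sE sT ET tg Tz /(adjoin1P sE)[p [q [Ep Eq q0 Dz]]].
have rT := is_subfield_subring sT.
have /eqP : z%:P * q - p = 0.
  apply: contrapT => /eqP P0; apply: tg; exists (z%:P * q - p); split=> //.
    apply: coefs_inB => //; last by move=> i; apply: ET.
    by apply: coefs_inM => //; [apply: coefs_inC|move=> i; apply: ET].
  by rewrite /root !hornerE Dz divfK // subrr.
rewrite subr_eq0 mul_polyC => /eqP Dp.
have lq0 : lead_coef q != 0.
  by rewrite lead_coef_eq0; apply: contra_neq q0 => ->; rewrite horner0.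
have := Ep (size q).-1; rewrite -Dp coefZ -lead_coefE => Ezq.
by rewrite -[z](mulfK lq0); case: sE => _ _; apply => //; apply: Eq.
Qed.

(** The [h s] fix the coefficients of a relation for x, hence map x to further roots of it; [size p]
    distinct roots are too many. *)
Lemma transcendental_endos E x (h : nat -> {rmorphism L -> L}) :
    (forall s z, E z -> h s z = z) -> injective (fun s => h s x) ->
  ~ algebraic_over E x.
Proof.
move=> hE hx [p [p0 Ep px]]; case/negP: p0; apply/eqP.
apply: (@roots_geq_poly_eq0 _ _ [seq h s x | s <- iota 0 (size p)]).
- apply/allP => _ /mapP[s _ ->]; rewrite rootE.
  have <- : map_poly (h s) p = p by apply/polyP => j; rewrite coef_map /= hE.
  by rewrite horner_map (eqP px) rmorph0.
- by rewrite map_inj_uniq ?iota_uniq.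
- by rewrite size_map size_iota.
Qed.

End AlgebraicClosure.

(** * Descent along a finite group action *)

Section GroupAction.
Variables (L : fieldType) (gT : finGroupType) (act : gT -> {rmorphism L -> L}).
Hypothesis act1 : forall z, act 1%g z = z.
Hypothesis actM : forall g h z, act (g * h)%g z = act g (act h z).
Implicit Types (G : {group gT}) (R S T E : L -> Prop).

Definition fixed_by (G : {set gT}) z := forall g, g \in G -> act g z = z.

Definition stable_under (G : {set gT}) S := forall g z, g \in G -> S z -> S (act g z).

Definition stabilizer (G : {set gT}) S : {set gT} :=
  [set g in G | `[< forall z, S z -> act g z = z >]].

Lemma stabilizerP (G : {set gT}) S g :
  reflect (g \in G /\ forall z, S z -> act g z = z) (g \in stabilizer G S).
Proof.
by rewrite inE; apply: (iffP andP) => -[gG /asboolP gS]; split=> //; apply/asboolP.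
Qed.

Lemma stabilizer_group_set G S : group_set (stabilizer G S).
Proof.
apply/group_setP; split=> [|g h /stabilizerP[gG gS] /stabilizerP[hG hS]].
  by apply/stabilizerP; split.
apply/stabilizerP; split=> [|z Sz]; first exact: groupM.
by rewrite actM hS // gS.
Qed.
Canonical stabilizer_group G S := Group (stabilizer_group_set G S).

Lemma fixed_subfield (G : {set gT}) : is_subfield (fixed_by G).
Proof.
split=> [g _|x y xG yG g gG|x y xG yG g gG]; first by rewrite rmorph1.
  by rewrite rmorphB xG // yG.
by rewrite fmorph_div xG // yG.
Qed.

Lemma fixed_stabilizer (G : {set gT}) S z : S z -> fixed_by (stabilizer G S) z.
Proof. by move=> Sz g /stabilizerP[_]; apply. Qed.

(** Acting by h permutes the factors ['X - (act g x)%:P], so their product has invariant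
    coefficients. *)
Lemma fixed_algebraic G x : algebraic_over (fixed_by G) x.
Proof.
exists (\prod_(g in G) ('X - (act g x)%:P)); split.
- by apply/prodf_neq0 => g _; rewrite polyXsubC_eq0.
- move=> i h hG; rewrite -coef_map; congr nth; congr polyseq.
  rewrite rmorph_prod [RHS](reindex_inj (mulgI h)) /=.
  apply: eq_big => g; first by rewrite groupMl.
  by rewrite rmorphB /= map_polyX map_polyC actM.
- rewrite rootE horner_prod; apply/prodf_eq0; exists 1%g; first exact: group1.
  by rewrite !hornerE act1 subrr.
Qed.

(** * Traces over cosets and Galois descent *)

Section Trace.
Variables (G : {group gT}) (R : L -> Prop).
Hypotheses (sR : is_subfield R) (stR : stable_under G R).
Let K := stabilizer_group G R.

(* The product over h in G \ K of (g b - h b) / (b - h b), for some b in R moved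
   by h, is 1 for g in K and 0 otherwise; expanding it gives the sum. *)
Lemma galois_coordinates :
  exists cs : seq (L * L),
    (forall ca, ca \in cs -> R ca.1 /\ R ca.2) /\
    forall g, g \in G -> \sum_(ca <- cs) ca.1 * act g ca.2 = (g \in K)%:R.
Proof.
have rR := is_subfield_subring sR.
suffices [cs [csR cs1 cs0]] : exists cs : seq (L * L),
    [/\ (forall ca, ca \in cs -> R ca.1 /\ R ca.2),
        forall g, g \in K -> \sum_(ca <- cs) ca.1 * act g ca.2 = 1
      & forall g, g \in enum (G :\: K) -> \sum_(ca <- cs) ca.1 * act g ca.2 = 0].
  exists cs; split=> // g gG; case: (boolP (g \in K)) => gK; first exact: cs1.
  by apply: cs0; rewrite mem_enum inE gK.
have : {subset enum (G :\: K) <= G :\: K} by move=> g; rewrite mem_enum.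
elim: (enum _) => [|h s IH] sub.
  exists [:: (1, 1)]; split=> // [ca|g gK].
    by rewrite inE => /eqP-> /=; split; apply: subring1.
  by rewrite big_seq1 /= rmorph1 mulr1.
have [|cs [csR cs1 cs0]] := IH; first by move=> g gs; apply: sub; rewrite inE gs orbT.
have /sub : h \in h :: s by rewrite mem_head.
rewrite inE => /andP[hK hG].
have [b Rb hb] : exists2 b, R b & act h b != b.
  apply: contrapT => nb; case/negP: hK; apply/stabilizerP; split=> // z Rz.
  by apply/eqP; apply/negPn/negP => hz; apply: nb; exists z.
pose d := (b - act h b)^-1.
have Rd : R d by apply: subfieldV => //; apply: subringB => //; apply: stR.
have db : d * (b - act h b) = 1 by rewrite mulVf // subr_eq0 eq_sym.
(* [bs] encodes the single factor [d * (act g b - act h b)], which vanishes at h and is 1 on K;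
   [prods] multiplies it into the list obtained for the remaining elements. *)
pose bs := [:: (d, b); (- (d * act h b), 1)].
have bsE g : \sum_(ca <- bs) ca.1 * act g ca.2 = d * (act g b - act h b).
  by rewrite big_cons big_seq1 /= rmorph1 mulr1 mulrBr.
pose prods := [seq (x.1 * y.1, x.2 * y.2) | x <- bs, y <- cs].
have sumE g : \sum_(ca <- prods) ca.1 * act g ca.2
    = d * (act g b - act h b) * \sum_(ca <- cs) ca.1 * act g ca.2.
  rewrite big_allpairs_dep -bsE mulr_suml; apply: eq_bigr => x _.
  by rewrite mulr_sumr; apply: eq_bigr => y _; rewrite /= rmorphM mulrACA.
exists prods; split=> [ca|g gK|g].
- case/allpairsP=> -[x y] /= [xbs /csR[Ry1 Ry2] ->] /=.
  have [Rx1 Rx2] : R x.1 /\ R x.2.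
    move: xbs; rewrite !inE => /orP[] /eqP-> //=; split; last exact: subring1.
    by apply: subringN => //; apply: subringM => //; apply: stR.
  by split; apply: subringM.
- by rewrite sumE cs1 // mulr1; have /stabilizerP[_ ->] := gK.
- by rewrite inE sumE => /predU1P[->|/cs0->]; rewrite ?subrr ?mulr0 ?mul0r.
Qed.

(** The trace from R to R^G. On K-invariants a sum over all of G would be |K| times this one, and
    |K| may be divisible by the characteristic. *)
Definition coset_trace z := \sum_(C in lcosets K G) act (repr C) z.

Lemma act_lcoset g h z : fixed_by K z -> (g *: K)%g = (h *: K)%g -> act g z = act h z.
Proof.
move=> Kz gK; have : g \in (h *: K)%g by rewrite -gK lcoset_refl.
by case/lcosetP=> k kK ->; rewrite actM Kz.
Qed.

Lemma repr_lcosets C : C \in lcosets K G ->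
  repr C \in G /\ (repr C *: K)%g = C.
Proof.
case/lcosetsP=> g gG ->; have rg : repr (g *: K)%g \in (g *: K)%g.
  exact: mem_repr (lcoset_refl _ _).
split; last exact/lcoset_eqP.
have /lcosetP[k /stabilizerP[kG _] ->] := rg; exact: groupM.
Qed.

(** Left multiplication permutes the cosets. It need not carry representatives to representatives,
    but on K-invariants only the coset matters. *)
Lemma coset_trace_fixed z : fixed_by K z -> fixed_by G (coset_trace z).
Proof.
move=> Kz g gG; rewrite rmorph_sum /=.
pose m (C : {set gT}) := (g *: C)%g.
have inj_m : injective m by apply: lcoset_inj.
rewrite /coset_trace [RHS](reindex_inj inj_m) /=.
have lcM C : (m C \in lcosets K G) = (C \in lcosets K G).
  have lcM1 D x : x \in G -> D \in lcosets K G -> (x *: D)%g \in lcosets K G.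
    move=> xG /lcosetsP[h hG ->]; apply/lcosetsP; exists (x * h)%g.
      exact: groupM.
    by rewrite lcosetM.
  apply/idP/idP => [mC|]; last exact: lcM1.
  by rewrite -[C](lcosetK g); apply: lcM1; rewrite ?groupV.
apply: eq_big => C; first by rewrite lcM.
move=> CG; rewrite -actM; apply: act_lcoset => //.
have [_ C1] := repr_lcosets CG.
have [_ ->] : repr (m C) \in G /\ (repr (m C) *: K)%g = m C.
  by apply: repr_lcosets; rewrite lcM.
by rewrite lcosetM C1.
Qed.

Lemma coset_trace_stable T z : is_subring T -> stable_under G T ->
  T z -> T (coset_trace z).
Proof.
move=> rT stT Tz; apply: subring_sum => // C /repr_lcosets[rG _].
exact: stT.
Qed.

Lemma coset_trace_sum (I : Type) (r : seq I) (P : pred I) (e f : I -> L) :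
    (forall i, P i -> fixed_by G (e i)) ->
  coset_trace (\sum_(i <- r | P i) e i * f i)
    = \sum_(i <- r | P i) e i * coset_trace (f i).
Proof.
move=> Ge; rewrite /coset_trace.
under eq_bigr do rewrite rmorph_sum; rewrite exchange_big /=.
apply: eq_bigr => i Pi; rewrite mulr_sumr; apply: eq_bigr => C /repr_lcosets[rG _].
by rewrite rmorphM (Ge i Pi).
Qed.

(** After exchanging the sums, the coset of h contributes h z times the sum of the c (h a), which is
    0 unless h is in K; only the trivial coset survives. *)
Lemma coset_traceE cs z :
    (forall ca, ca \in cs -> R ca.1 /\ R ca.2) ->
    (forall g, g \in G -> \sum_(ca <- cs) ca.1 * act g ca.2 = (g \in K)%:R) ->
    fixed_by K z ->
  z = \sum_(ca <- cs) ca.1 * coset_trace (ca.2 * z).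
Proof.
move=> csR csK Kz; rewrite /coset_trace; under eq_bigr do rewrite mulr_sumr.
rewrite exchange_big /=.
under eq_bigr => C _.
  under eq_bigr do rewrite rmorphM mulrA.
  rewrite -mulr_suml; over.
have KG : (K : {set gT}) \in lcosets K G.
  by apply/lcosetsP; exists 1%g; rewrite ?group1 // mul1g.
rewrite (bigD1 (K : {set gT})) //= [X in _ = _ + X]big1 ?addr0.
  have [rG rK] := repr_lcosets KG.
  have rKK : repr K \in K by apply: mem_repr (group1 K).
  by rewrite csK // rKK mul1r Kz.
move=> C /andP[/repr_lcosets[rG rC] CK]; rewrite csK //.
case: (boolP (_ \in _)) => [rK|_]; last by rewrite mul0r.
by case/eqP: CK; rewrite -rC lcoset_id.
Qed.

(** If every trace of an element of R vanished, the expansion of 1 by [coset_traceE] would give 1 =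
    0. *)
Lemma coset_trace_neq0 : exists2 a, R a & coset_trace a != 0.
Proof.
have [cs [csR csK]] := galois_coordinates.
apply: contrapT => na; have /eqP := oner_neq0 L; apply.
rewrite {1}(@coset_traceE cs 1) //; last by move=> g _; rewrite rmorph1.
rewrite big_seq big1 // => ca /csR[_ Ra]; rewrite mulr1.
case: (eqVneq (coset_trace ca.2) 0) => [->|a0]; first by rewrite mulr0.
by case: na; exists ca.2.
Qed.

(** Galois descent from K to G: in the expansion of z by [coset_traceE] the coefficients lie in R,
    and the traces are G-invariant elements of T. *)
Lemma fixed_descent T z : is_subring T -> stable_under G T ->
    (forall x, R x -> T x) -> T z -> fixed_by K z ->
  gen_subfield (fun u => R u \/ T u /\ fixed_by G u) z.
Proof.
move=> rT stT RT Tz Kz; have [cs [csR csK]] := galois_coordinates.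
rewrite (coset_traceE csR csK Kz) big_seq.
have rA := gen_subring (fun u => R u \/ T u /\ fixed_by G u).
apply: (subring_sum rA) => ca /csR[R1 R2]; apply: (subringM rA).
  by apply: mem_gen; left.
apply: mem_gen; right; split.
  apply: (coset_trace_stable rT stT); exact: (subringM rT (RT _ R2) Tz).
apply: coset_trace_fixed.
have rF := is_subfield_subring (fixed_subfield K).
by apply: (subringM rF) => //; apply: fixed_stabilizer.
Qed.

End Trace.

(* Sp is a field: the inverse of x is the product of its other conjugates divided
   by its norm, which is an invariant of Sp. *)
Lemma fixed_gen_ring G (Sp E A : L -> Prop) z :
    is_subring Sp -> stable_under G Sp -> is_subfield E ->
    (forall x, E x -> Sp x) -> (forall x, Sp x -> fixed_by G x -> E x) ->
    (forall x, A x -> Sp x) ->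
  gen_subfield A z -> fixed_by G z -> E z.
Proof.
move=> rSp stSp sE ESp SpE ASp Az; apply: (SpE); move: z Az; apply: gen_min => //.
apply: subring_subfield => // x Spx.
have [->|x0] := eqVneq x 0; first by rewrite invr0; apply: subring0.
pose N := \prod_(g in G) act g x.
have N0 : N != 0 by apply/prodf_neq0 => g _; rewrite fmorph_eq0.
have DN : N = x * \prod_(g in G | g != 1%g) act g x.
  by rewrite /N (bigD1 1%g) //= act1.
have -> : x^-1 = N^-1 * \prod_(g in G | g != 1%g) act g x.
  by apply: (mulfI x0); rewrite mulrCA -DN mulVf // mulfV.
apply: subringM => //; last first.
  by apply: subring_prod => // g /andP[gG _]; apply: stSp.
apply: ESp; apply: subfieldV => //; apply: SpE.
  by apply: subring_prod => // g gG; apply: stSp.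
move=> h hG; rewrite rmorph_prod /= /N [RHS](reindex_inj (mulgI h)) /=.
by apply: eq_big => g; rewrite ?groupMl // actM.
Qed.

(* The E-span of R, for E = R^G(S), is a ring containing R and S; multiplying an
   invariant of the span by a nonzero trace of an element of R puts it in E. *)
Lemma fixed_gen_adjoin G R S z : is_subfield R -> stable_under G R ->
    (forall x, S x -> fixed_by G x) ->
    gen_subfield (fun u => R u \/ S u) z -> fixed_by G z ->
  gen_subfield (fun u => (R u /\ fixed_by G u) \/ S u) z.
Proof.
move=> sR stR SG Az Gz; set E := gen_subfield _.
have rR := is_subfield_subring sR; have rE : is_subring E by apply: gen_subring.
have EG x : E x -> fixed_by G x.
  apply: gen_min => [|{}x]; first exact: fixed_subfield.
  by move=> [[_ Gx]|/SG].
pose Sp x := exists2 s : seq (L * L),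
  forall er, er \in s -> E er.1 /\ R er.2 & x = \sum_(er <- s) er.1 * er.2.
have ERSp e r : E e -> R r -> Sp (e * r).
  move=> Ee Rr; exists [:: (e, r)]; last by rewrite big_seq1.
  by move=> er; rewrite inE => /eqP->.
have E1 := subring1 rE; have R1 := subring1 rR.
have ESp x : E x -> Sp x by rewrite -[x in Sp x]mulr1 => /ERSp; apply.
have RSp x : R x -> Sp x by rewrite -[x in Sp x]mul1r => /(ERSp _ _ E1).
have sE : is_subfield E by apply: gen_subfieldP.
apply: (@fixed_gen_ring G Sp E _ z _ _ sE ESp _ _ Az Gz) => //; last 2 first.
- move=> x [s sP Dx] Gx; have [a Ra ta0] := coset_trace_neq0 sR stR.
  have Ga : fixed_by G (coset_trace G R a).
    by apply: coset_trace_fixed; apply: fixed_stabilizer.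
  have Eta r : R r -> E (coset_trace G R r).
    move=> Rr; apply: mem_gen; left; split; first exact: coset_trace_stable.
    by apply: coset_trace_fixed; apply: fixed_stabilizer.
  (* Since x is invariant, x tr(a) = tr(x a). The trace is linear over E, so this is a combination
     over E of the tr(r a) with r in R, and these lie in R^G. *)
  rewrite -[x](mulfK ta0); case: (sE) => _ _; apply; last exact: Eta.
  have -> : x * coset_trace G R a = \sum_(er <- s) er.1 * coset_trace G R (er.2 * a).
    have -> : x * coset_trace G R a = coset_trace G R (x * a).
      have := @coset_trace_sum G R _ [:: tt] predT (fun=> x) (fun=> a) (fun _ _ => Gx).
      by rewrite !big_seq1.
    rewrite Dx mulr_suml; under eq_bigr do rewrite -mulrA.
    by rewrite big_seq [RHS]big_seq; apply: coset_trace_sum => er /sP[/EG].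
  rewrite big_seq; apply: (subring_sum rE) => er /sP[Ee Rr].
  by apply: (subringM rE) => //; apply: Eta; apply: subringM.
- by move=> x [/RSp//|Sx]; apply: ESp; apply: mem_gen; right.
- split=> [|x y [s sP ->] [s' sP' ->]|x y [s sP ->] [s' sP' ->]]; first exact: ESp.
    exists (s ++ [seq (- er.1, er.2) | er <- s']) => [er|].
      rewrite mem_cat => /orP[/sP//|/mapP[er' /sP'[Ee Rr] ->]] /=.
      by split=> //; apply: (subringN rE).
    rewrite big_cat big_map /= -sumrN; congr (_ + _).
    by apply: eq_bigr => er _; rewrite mulNr.
  exists [seq (u.1 * v.1, u.2 * v.2) | u <- s, v <- s'].
    move=> _ /allpairsP[[u v] /= [/sP[Eu Ru] /sP'[Ev Rv] ->]] /=.
    by split; [apply: (subringM rE)|apply: (subringM rR)].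
  rewrite big_allpairs_dep mulr_suml; apply: eq_bigr => u _.
  by rewrite mulr_sumr; apply: eq_bigr => v _; rewrite mulrACA.
- move=> g x gG [s sP ->]; exists [seq (er.1, act g er.2) | er <- s].
    by move=> _ /mapP[er /sP[Ee Rr] ->]; split=> //; apply: stR.
  rewrite rmorph_sum big_map [LHS]big_seq [RHS]big_seq.
  by apply: eq_bigr => er /sP[Ee _]; rewrite rmorphM (EG _ Ee).
Qed.

(* An invariant g(y), with g over E(N) and deg g < |U|, equals g(y + u) for all
   u in U, so that the polynomial g - g(y) has too many roots. *)
Lemma fixed_gen_translations G E (y : L) (U : seq L) z :
    is_subfield E -> (forall x, E x -> fixed_by G x) -> uniq U ->
    (0 < size U)%N -> (forall u, u \in U -> E u) ->
    (forall u, u \in U -> exists2 g, g \in G & act g y = y + u) ->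
    (forall g, g \in G -> E (act g y - y)) ->
    fixed_by G (\prod_(u <- U) (y + u)) ->
    adjoin E [:: y] z -> fixed_by G z ->
  adjoin E [:: \prod_(u <- U) (y + u)] z.
Proof.
move=> sE EG uU U0 EU UG GE; set N := \prod_(u <- U) (y + u) => GN.
set E' := adjoin E [:: N]; have sE' : is_subfield E' by apply: adjoin_subfield.
have rE' := is_subfield_subring sE'.
have E'G x : E' x -> fixed_by G x.
  apply: adjoin_min => [|//|{}x]; first exact: fixed_subfield.
  by rewrite inE => /eqP->.
pose Sp x := exists2 g : {poly L}, coefs_in E' g & x = g.[y].
have SpE' x : E' x -> Sp x.
  by move=> E'x; exists x%:P; rewrite ?hornerC //; apply: coefs_inC.
have Spy : Sp y by exists 'X; rewrite ?hornerX //; apply: coefs_inX.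
have rSp : is_subring Sp.
  split=> [|_ _ [p Ep ->] [q Eq ->]|_ _ [p Ep ->] [q Eq ->]].
  - by apply: SpE'; apply: subring1.
  - by exists (p - q); rewrite ?hornerE //; apply: coefs_inB.
  - by exists (p * q); rewrite ?hornerE //; apply: coefs_inM.
apply: (@fixed_gen_ring G Sp) => //; last first.
- move=> x [Ex|]; last by rewrite inE => /eqP->.
  by apply: SpE'; apply: adjoin_base.
(* [Q] has degree |U|, coefficients in E(N) and root y: reduction modulo [Q] brings the degree of p
   below |U|. *)
- move=> _ [p Ep ->] Gp; pose Q := \prod_(u <- U) ('X + u%:P) - N%:P.
  have prodE : \prod_(u <- U) ('X + u%:P) = \prod_(u <- map -%R U) ('X - u%:P).
    by rewrite big_map; apply: eq_bigr => u _; rewrite polyCN opprK.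
  have sizeP : size (\prod_(u <- U) ('X + u%:P)) = (size U).+1.
    by rewrite prodE size_prod_XsubC size_map.
  have sizeQ : size Q = (size U).+1.
    rewrite /Q size_polyDl sizeP // size_polyN ltnS.
    exact: leq_trans (size_polyC_leq1 _) U0.
  have [|||g [Eg sg gy]] := @coefs_in_mod L E' p Q y sE' Ep.
  - apply: coefs_inB => //; last first.
      by apply: coefs_inC => //; apply: adjoin_mem; rewrite mem_head.
    rewrite big_seq; apply: coefs_in_prod => // u /EU Eu i.
    rewrite coefD; apply: (subringD rE'); first exact: coefs_inX.
    by apply: coefs_inC => //; apply: adjoin_base.
  - by rewrite -size_poly_gt0 sizeQ.
  - rewrite /root !hornerE horner_prod /N subr_eq0; apply/eqP.
    by apply: eq_bigr => u _; rewrite !hornerE.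
  have : g - (p.[y])%:P = 0.
    apply: (@roots_geq_poly_eq0 _ _ [seq y + u | u <- U]).
    - apply/allP => _ /mapP[u uU' ->]; have [h hG hy] := UG u uU'.
      rewrite /root !hornerE subr_eq0 -(Gp h hG) -gy -hy -horner_map; apply/eqP.
      congr _.[_]; apply/polyP => i; rewrite coef_map /= (E'G _ (Eg i)) //.
    - by rewrite map_inj_uniq //; apply: addrI.
    - rewrite size_map; rewrite sizeQ ltnS in sg.
      apply: leq_trans (size_polyD _ _) _; rewrite size_polyN geq_max sg /=.
      exact: leq_trans (size_polyC_leq1 _) U0.
  move/eqP; rewrite subr_eq0 => /eqP/(congr1 (fun f : {poly L} => f`_0)).
  by rewrite coefC /= => <-; apply: Eg.
- move=> g _ gG [p Ep ->]; rewrite -horner_map; apply: horner_in => //.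
    by move=> i; rewrite coef_map /= (E'G _ (Ep i)) //; apply: SpE'.
  rewrite -[act g y](subrK y); apply: subringD => //.
  by apply: SpE'; apply: adjoin_base; apply: GE.
Qed.

End GroupAction.

Lemma fracP (A : idomainType) (z : {fraction A}) :
  exists a b : A, b != 0 /\ z = tofrac a / tofrac b.
Proof.
by do 2!eexists; split; last exact: tofrac_div; apply: denom_ratioP.
Qed.

(** * Rational functions and linear substitutions *)

Section FracMap.
Variables (A B : idomainType) (phi : {rmorphism A -> B}).
Hypothesis phi_inj : injective phi.

(** The map respects the operations only for injective [phi]; carrying that proof in the term lets
    the morphism instances be attached to it. *)
Definition fmap_of (_ : injective phi) := @frac_map A B phi.
Local Notation fmap := (fmap_of phi_inj).

Let phi_neq0 a : a != 0 -> tofrac (phi a) != 0.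
Proof. by rewrite tofrac_eq0; apply: contra_neq; rewrite -(rmorph0 phi) => /phi_inj. Qed.

Lemma fmap_tofrac a : fmap (tofrac a) = tofrac (phi a).
Proof.
have := frac_mapE a phi_inj (oner_neq0 A).
by rewrite !rmorph1 !divr1.
Qed.

Fact fmap_is_zmod : zmod_morphism fmap.
Proof.
move=> x y; have [a [b [b0 ->]]] := fracP x; have [c [d [d0 ->]]] := fracP y.
rewrite -mulNr addf_div ?tofrac_eq0 // -!tofracN -!tofracM -!tofracD.
rewrite /fmap_of !frac_mapE ?mulf_neq0 // -mulNr addf_div ?phi_neq0 //.
by rewrite -tofracN -!tofracM -!tofracD !rmorphM rmorphD !rmorphM rmorphN.
Qed.

Fact fmap_is_monoid : monoid_morphism fmap.
Proof.
split; first by rewrite -tofrac1 fmap_tofrac rmorph1 tofrac1.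
move=> x y; have [a [b [b0 ->]]] := fracP x; have [c [d [d0 ->]]] := fracP y.
rewrite mulf_div -!tofracM /fmap_of !frac_mapE ?mulf_neq0 // mulf_div.
by rewrite -!tofracM !rmorphM.
Qed.

HB.instance Definition _ :=
  GRing.isZmodMorphism.Build {fraction A} {fraction B} fmap fmap_is_zmod.
HB.instance Definition _ :=
  GRing.isMonoidMorphism.Build {fraction A} {fraction B} fmap fmap_is_monoid.

End FracMap.

Section RationalFunctions.
Variables (F : fieldType) (m : nat).
Local Notation L := {fraction {mpoly F[m]}}.
Implicit Type P : pred 'I_m.

Definition fconst (u : L) : Prop := exists c : F, u = tofrac c%:MP.

Definition fvars P (u : L) : Prop :=
  fconst u \/ exists2 k, P k & u = tofrac 'X_k.

Definition varfield P := gen_subfield (fvars P).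

Lemma varfieldP P : is_subfield (varfield P).
Proof. exact: gen_subfieldP. Qed.

Lemma varfield_ring P : is_subring (varfield P).
Proof. exact: gen_subring. Qed.

Lemma varfield_const P c : varfield P (tofrac c%:MP).
Proof. by apply: mem_gen; left; exists c. Qed.

Lemma varfield_var P k : P k -> varfield P (tofrac 'X_k).
Proof. by move=> Pk; apply: mem_gen; right; exists k. Qed.

Lemma varfield_sub P Q : subpred P Q -> forall z, varfield P z -> varfield Q z.
Proof.
move=> PQ; apply: gen_mono => u [uc|[k /PQ Qk uk]]; apply: mem_gen; [by left|].
by right; exists k.
Qed.

Lemma tofrac_varfield P (p : {mpoly F[m]}) :
  (forall mm k, mm \in msupp p -> mm k != 0%N -> P k) -> varfield P (tofrac p).
Proof.
move=> pP; have rP := varfield_ring P.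
rewrite (mpolyE p) rmorph_sum big_seq; apply: (subring_sum rP) => mm mp /=.
rewrite -mul_mpolyC tofracM; apply: (subringM rP); first exact: varfield_const.
rewrite mpolyXE_id rmorph_prod; apply: (subring_prod rP) => k _ /=.
rewrite rmorphXn /=; have [->|mk] := eqVneq (mm k) 0%N; first exact: subring1.
by apply: (subringX rP); apply: varfield_var; apply: pP mk.
Qed.

Lemma varfieldT z : varfield predT z.
Proof.
have [a [b [_ ->]]] := fracP z; have [_ _] := varfieldP predT; apply;
  exact: tofrac_varfield.
Qed.

Lemma varfield_stable P (M : fieldType) (T : M -> Prop) (h : {rmorphism L -> M}) :
    is_subfield T -> (forall c, T (h (tofrac c%:MP))) ->
    (forall k, P k -> T (h (tofrac 'X_k))) ->
  forall z, varfield P z -> T (h z).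
Proof.
by move=> sT Tc Tx; apply: gen_rmorph => // u [[c ->]|[k Pk ->]]; [apply: Tc|apply: Tx].
Qed.

Lemma varfield_eq P (M : fieldType) (h1 h2 : {rmorphism L -> M}) :
    (forall c, h1 (tofrac c%:MP) = h2 (tofrac c%:MP)) ->
    (forall k, P k -> h1 (tofrac 'X_k) = h2 (tofrac 'X_k)) ->
  forall z, varfield P z -> h1 z = h2 z.
Proof.
by move=> hc hx; apply: gen_rmorph_eq => u [[c ->]|[k Pk ->]]; [apply: hc|apply: hx].
Qed.

End RationalFunctions.

Arguments fconst {F m}.

(** * Finite groups of linear automorphisms acting on rational functions *)

Section LinearAction.
Variables (F : finFieldType) (U : vectType F) (m : nat) (b : m.-tuple U).
Hypothesis b_basis : basis_of fullv b.
Local Notation L := {fraction {mpoly F[m]}}.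

Lemma linear_lincomb (h : U -> U) (I : Type) (r : seq I) (c : I -> F) (v : I -> U) :
  linear h -> h (\sum_(i <- r) c i *: v i) = \sum_(i <- r) c i *: h (v i).
Proof.
move=> hl; pose h' : {linear U -> U} := HB.pack h (GRing.isLinear.Build F U U _ h hl).
rewrite -[h]/(h' : U -> U) linear_sum; apply: eq_bigr => i _.
by rewrite linearZ.
Qed.

HB.instance Definition _ h := GRing.RMorphism.copy (poly_act b h)
  (comp_mpoly [tuple pullback b h i | i < m]).

Lemma poly_actC h c : poly_act b h c%:MP = c%:MP.
Proof. exact: comp_mpolyC. Qed.

Lemma poly_actZ h c p : poly_act b h (c *: p) = c *: poly_act b h p.
Proof. exact: comp_mpolyZ. Qed.

Lemma poly_actX h i : poly_act b h 'X_i = pullback b h i.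
Proof. by rewrite /poly_act comp_mpolyXU -tnth_nth tnth_mktuple. Qed.

Lemma mpoly_rmorph_eq (R : nzRingType) (h1 h2 : {rmorphism {mpoly F[m]} -> R}) :
    (forall c, h1 c%:MP = h2 c%:MP) -> (forall i, h1 'X_i = h2 'X_i) ->
  h1 =1 h2.
Proof.
move=> hc hx p; rewrite (mpolyE p) !rmorph_sum; apply: eq_bigr => mm _ /=.
rewrite -mul_mpolyC !rmorphM hc mpolyXE_id !rmorph_prod; congr (_ * _).
by apply: eq_bigr => i _; rewrite !rmorphXn hx.
Qed.

Lemma poly_act_comp h1 h2 p : linear h1 ->
  poly_act b h2 (poly_act b h1 p) = poly_act b (h1 \o h2) p.
Proof.
move=> h1l; rewrite -[LHS]/((poly_act b h2 \o poly_act b h1) p).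
apply: mpoly_rmorph_eq => [c|i] /=; first by rewrite !poly_actC.
rewrite !poly_actX rmorph_sum /=.
under eq_bigr do rewrite poly_actZ poly_actX scaler_sumr.
rewrite exchange_big; apply: eq_bigr => k _ /=.
under eq_bigr do rewrite scalerA; rewrite -scaler_suml; congr (_ *: _).
rewrite [in RHS](coord_basis b_basis (memvf (h2 b`_k))) linear_lincomb // linear_sum.
by apply: eq_bigr => j _; rewrite linearZ mulrC.
Qed.

Lemma poly_act_id p : poly_act b id p = p.
Proof.
rewrite -[RHS]/((idfun : {rmorphism _ -> _}) p).
apply: mpoly_rmorph_eq => [c|i] /=; first by rewrite poly_actC.
rewrite poly_actX /pullback (bigD1 i) //= coord_free ?eqxx ?(basis_free b_basis) //.
rewrite scale1r big1 ?addr0 // => j ji.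
by rewrite coord_free ?(basis_free b_basis) // (negPf ji) scale0r.
Qed.

(** The descent lemmas ask for a finite group. As F is finite so is U, and each group at hand is
    realised among the linear permutations of U. *)
Definition linear_perms : {set {perm finvect_type U}} :=
  [set s : {perm finvect_type U} | `[< linear (s : U -> U) >]].

Lemma linear_perms_group_set : group_set linear_perms.
Proof.
apply/group_setP; split=> [|s t]; rewrite !inE.
  by apply/asboolP => a u v; rewrite !perm1.
move=> /asboolP sl /asboolP tl; apply/asboolP => a u v.
by rewrite !permM -[RHS]tl -[in RHS]sl.
Qed.
Canonical linear_perms_group := Group linear_perms_group_set.

(** A group type all of whose elements are linear, because the abstract action must be a field
    morphism for every element of the type. *)
Definition linear_aut : finGroupType := subg_of linear_perms_group.

Definition aut_fun (s : linear_aut) : U -> U := fun u => sgval s u.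

Lemma aut_fun_linear s : linear (aut_fun s).
Proof. by have := subgP s; rewrite inE => /asboolP. Qed.

Lemma aut_fun1 : aut_fun 1%g = id.
Proof. by apply/funext => u; rewrite /aut_fun morph1 perm1. Qed.

Lemma aut_funM s t : aut_fun (s * t)%g = aut_fun t \o aut_fun s.
Proof. by apply/funext => u; rewrite /aut_fun morphM ?inE // permM. Qed.

Lemma poly_act_aut_inj s : injective (poly_act b (aut_fun s)).
Proof.
apply: (can_inj (g := poly_act b (aut_fun s^-1%g))) => p.
by rewrite poly_act_comp ?poly_act_id //;
  [rewrite -aut_funM mulVg aut_fun1 poly_act_id | apply: aut_fun_linear].
Qed.

Definition frac_aut (s : linear_aut) : {rmorphism L -> L} :=
  fmap_of (@poly_act_aut_inj s).

Lemma frac_autE s z : frac_aut s z = frac_act b (aut_fun s) z.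
Proof. by []. Qed.

Lemma frac_aut_tofrac s p : frac_aut s (tofrac p) = tofrac (poly_act b (aut_fun s) p).
Proof. exact: fmap_tofrac. Qed.

Lemma frac_aut_const s c : frac_aut s (tofrac c%:MP) = tofrac c%:MP.
Proof. by rewrite frac_aut_tofrac poly_actC. Qed.

Lemma frac_aut1 z : frac_aut 1%g z = z.
Proof.
have [p [q [_ ->]]] := fracP z.
by rewrite fmorph_div !frac_aut_tofrac aut_fun1 !poly_act_id.
Qed.

(** Permutations multiply from left to right and pullback is contravariant; the two reversals cancel
    and leave a left action. *)
Lemma frac_autM s t z : frac_aut (s * t)%g z = frac_aut s (frac_aut t z).
Proof.
have [p [q [_ ->]]] := fracP z.
have actE u a c : frac_aut u (tofrac a / tofrac c)
    = tofrac (poly_act b (aut_fun u) a) / tofrac (poly_act b (aut_fun u) c).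
  by rewrite fmorph_div !frac_aut_tofrac.
by rewrite !actE aut_funM !poly_act_comp //; apply: aut_fun_linear.
Qed.

Definition auts_in (H : (U -> U) -> Prop) : {set linear_aut} :=
  [set s | `[< H (aut_fun s) >]].

Lemma auts_inP H s : reflect (H (aut_fun s)) (s \in auts_in H).
Proof. by rewrite inE; apply: asboolP. Qed.

Lemma auts_in_group_set (H : (U -> U) -> Prop) :
    H id -> (forall g h, H g -> H h -> H (g \o h)) ->
  group_set (auts_in H).
Proof.
move=> H1 HM; apply/group_setP; split=> [|s t /auts_inP Hs /auts_inP Ht].
  by apply/auts_inP; rewrite aut_fun1.
by apply/auts_inP; rewrite aut_funM; apply: HM.
Qed.

Lemma aut_exists (h : U -> U) : linear h -> injective h ->
  exists s : linear_aut, aut_fun s = h.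
Proof.
move=> hl h_inj; pose s : {perm finvect_type U} := @perm (finvect_type U) h h_inj.
have sl : s \in linear_perms_group.
  by rewrite inE; apply/asboolP => a u v; rewrite !permE; apply: hl.
exists (subg linear_perms_group s); apply/funext => u.
by rewrite /aut_fun subgK // permE.
Qed.

Lemma inv_fieldE (T : Type) (H : T -> Prop) (rho : T -> U -> U) z :
    (forall t, H t -> linear (rho t) /\ injective (rho t)) ->
  inv_field b H rho z <->
  fixed_by frac_aut (auts_in (fun h => exists2 t, H t & h = rho t)) z.
Proof.
move=> Hrho; split=> [Hz s /auts_inP[t Ht st]|Gz t Ht].
  by rewrite frac_autE st; apply: Hz.
have [rl ri] := Hrho t Ht; have [s st] := aut_exists rl ri.
by rewrite -st -frac_autE; apply: Gz; apply/auts_inP; exists t.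
Qed.

End LinearAction.

(** * Transcendence of the generators *)

Section Frobenius.
Variables (F : finFieldType) (m : nat).
Implicit Type p : {mpoly F[m]}.

Lemma card_finField_pnat (R : lalgType F) s : [pchar R].-nat (#|F| ^ s)%N.
Proof.
have [p p_pr pF] := finPcharP F.
rewrite (card_pprimeChar pF) -expnM pnatX; apply/orP; left.
by rewrite pnatE // pchar_lalg.
Qed.

Lemma expf_card_pow (c : F) s : c ^+ (#|F| ^ s) = c.
Proof. by elim: s => [|s IH]; rewrite ?expr1 // expnS exprM expf_card. Qed.

(** Raising to a power of q = |F| is additive and fixes the scalars. *)
Lemma comp_mpoly_card_pow p s :
  p \mPo [tuple 'X_i ^+ (#|F| ^ s) | i < m] = p ^+ (#|F| ^ s).
Proof.
set Q := (_ ^ _)%N.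
have Q0 : (0 < Q)%N by rewrite expn_gt0 (ltn_trans _ (finNzRing_gt1 F)).
elim/mpolyind: p => [|c mm p _ _ IH]; first by rewrite comp_mpoly0 expr0n eqn0Ngt Q0.
rewrite comp_mpolyD IH exprDn_pchar; last exact: card_finField_pnat.
congr (_ + _); rewrite comp_mpolyZ exprZn expf_card_pow comp_mpolyX; congr (_ *: _).
rewrite [in RHS]mpolyXE_id -prodrXl; apply: eq_bigr => i _.
by rewrite tnth_mktuple -!exprM mulnC.
Qed.

(* Composing with the complementary substitution gives P(X^Q) = P^Q. *)
Definition pow_vars (A : pred 'I_m) s : m.-tuple {mpoly F[m]} :=
  [tuple if A i then 'X_i ^+ (#|F| ^ s) else 'X_i | i < m].

Lemma comp_pow_varsX A s i :
  'X_i \mPo pow_vars A s = if A i then 'X_i ^+ (#|F| ^ s) else 'X_i.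
Proof. by rewrite comp_mpolyXU -tnth_nth tnth_mktuple. Qed.

Lemma comp_pow_vars_inj A s : injective (comp_mpoly (pow_vars A s)).
Proof.
apply: raddf_inj => p p0.
suff : p ^+ (#|F| ^ s) = 0 by move/eqP; rewrite expf_eq0 => /andP[_ /eqP].
rewrite -comp_mpoly_card_pow.
have -> : p \mPo [tuple 'X_i ^+ (#|F| ^ s) | i < m]
    = (p \mPo pow_vars A s) \mPo pow_vars (predC A) s.
  rewrite -[RHS]/((comp_mpoly (pow_vars (predC A) s) \o comp_mpoly (pow_vars A s)) p).
  apply: mpoly_rmorph_eq => [c|i] /=; first by rewrite !comp_mpolyC.
  rewrite comp_mpolyXU -tnth_nth tnth_mktuple comp_pow_varsX.
  case: ifP => Ai; last by rewrite comp_pow_varsX /= Ai.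
  by rewrite rmorphXn /= comp_pow_varsX /= Ai.
by rewrite p0 comp_mpoly0.
Qed.

Local Notation L := {fraction {mpoly F[m]}}.

(* The endomorphisms X_i -> X_i^(q^s) fix the other variables, so a polynomial
   relation for X_i would have all the X_i^(q^s) as roots. *)
Lemma var_transcendental (i : 'I_m) :
  ~ algebraic_over (varfield (predC1 i)) (tofrac 'X_i : L).
Proof.
pose h s : {rmorphism L -> L} := fmap_of (@comp_pow_vars_inj (pred1 i) s).
have hX s : h s (tofrac 'X_i) = tofrac ('X_i ^+ (#|F| ^ s)).
  by rewrite [LHS]fmap_tofrac /= comp_pow_varsX /= eqxx.
apply: (transcendental_endos (h := h)) => [s z|s t /=].
  apply: (@varfield_eq F m (predC1 i) L (h s) idfun) => [c|k /= ki].
    by rewrite [LHS]fmap_tofrac /= comp_mpolyC.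
  by rewrite [LHS]fmap_tofrac /= comp_pow_varsX /= (negPf ki).
rewrite !hX => /eqP; rewrite tofrac_eq => /eqP.
rewrite !mpolyXn => /(congr1 (fun p : {mpoly F[m]} => mlead p)).
rewrite !mleadXm => /(congr1 (fun mm : 'X_{1..m} => mm i)).
rewrite !mulmnE mnm1E eqxx !mul1n => /eqP.
by rewrite eqn_exp2l ?finNzRing_gt1 // => /eqP.
Qed.

Lemma alg_independent_vars (s : seq 'I_m) (E : L -> Prop) : uniq s ->
    (forall z, E z -> varfield (fun k => k \notin s) z) ->
  alg_independent E [seq tofrac 'X_k | k <- s].
Proof.
elim: s E => //= i s IH E /andP[i_s s_uniq] EV; split.
  case=> p [p0 Ep px]; apply: (@var_transcendental i); exists p; split=> // j.
  apply: varfield_sub (EV _ (Ep j)) => k /=; rewrite inE negb_or.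
  by case/andP.
apply: IH => // z; apply: adjoin_min => [|{}z /EV|{}z].
- exact: varfieldP.
- by apply: varfield_sub => k; rewrite inE negb_or => /andP[].
- by rewrite inE => /eqP->; apply: varfield_var.
Qed.

Definition fgen (f : 'I_m -> {mpoly F[m]}) (P : pred 'I_m) (u : L) : Prop :=
  fconst u \/ exists2 j, P j & u = tofrac (f j).

(** * Discarding the generators outside a tail of the variables *)

Section Triangular.
Variables (f : 'I_m -> {mpoly F[m]}) (r : nat).
Hypothesis f_tail : forall j : 'I_m, (r <= j)%N ->
  varfield (fun k => (r <= k)%N) (tofrac (f j)).
Hypothesis f_alg : forall z : L, algebraic_over (gen_subfield (fgen f predT)) z.

(* Otherwise F(y) would be algebraic over n - 1 elements. *)
Lemma triangular_transcendental (j : 'I_m) (T : L -> Prop) : (j < r)%N ->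
    (forall z, T z -> gen_subfield
       (fun u => varfield (fun k => (r <= k)%N) u \/ fgen f (predC1 j) u) z) ->
  ~ algebraic_over T (tofrac (f j)).
Proof.
move=> jr TE aj.
(* One element for each k other than j: the variable itself in the tail, [f k] below it. The [f k]
   of the tail lie in the field of the tail variables by [f_tail]. *)
pose gs : seq L := [seq (if (r <= (k : 'I_m))%N then tofrac 'X_k else tofrac (f k))
                   | k <- enum (predC1 j)].
pose E : L -> Prop := varfield (pred0 : pred 'I_m).
pose A := algebraic_over (adjoin E gs).
have sE : is_subfield E by apply: varfieldP.
have sA : is_subfield A by apply: algebraic_over_subfield; apply: adjoin_subfield.
have AA z : adjoin E gs z -> A z.
  by apply: algebraic_over_self; apply: adjoin_subfield.
have tailA z : varfield (fun k => (r <= k)%N) z -> A z.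
  apply: (@varfield_stable F m _ _ A idfun) => [//|c|k rk] /=; apply: AA.
    by apply: adjoin_base; apply: varfield_const.
  apply: adjoin_mem; apply/mapP; exists k; rewrite ?rk // mem_enum inE.
  by apply: contraTneq rk => ->; rewrite -ltnNge.
have fA k : A (tofrac (f k)).
  have fA1 k' : k' != j -> A (tofrac (f k')).
    move=> k'j; have [rk|kr] := leqP r k'; first by apply: tailA; apply: f_tail.
    apply: AA; apply: adjoin_mem; apply/mapP; exists k'; first by rewrite mem_enum.
    by rewrite leqNgt kr.
  have [->|] := eqVneq k j; last exact: fA1.
  apply: algebraic_over_trans (adjoin_subfield _ _) _ aj => z /TE.
  apply: (gen_min (S := A) sA) => u [/tailA//|[[c ->]|[k' k'j ->]]]; last exact: fA1.
  by apply: AA; apply: adjoin_base; apply: varfield_const.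
have allA z : A z.
  apply: algebraic_over_trans (adjoin_subfield _ _) _ (f_alg z) => u.
  apply: (gen_min (S := A) sA) => _ [[c ->]|[k _ ->]]; last exact: fA.
  by apply: AA; apply: adjoin_base; apply: varfield_const.
have ind : alg_independent E [seq tofrac 'X_k | k <- enum 'I_m].
  apply: alg_independent_vars; first exact: enum_uniq.
  by move=> z; apply: varfield_sub.
have := alg_independent_size sE ind (fun y _ => allA y).
rewrite size_map size_enum_ord size_map -cardE cardC1 card_ord leqNgt ltn_predL.
by rewrite (leq_ltn_trans _ (ltn_ord j)).
Qed.

(** The f_j with j < r are dropped in increasing order: f_j is transcendental over the field of the
    tail variables and the later f's, which contains z, so [adjoin_transcendental] applies. *)
Lemma triangular_descent z :
    varfield (fun k => (r <= k)%N) z -> gen_subfield (fgen f predT) z ->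
  gen_subfield (fgen f (fun j => (r <= j)%N)) z.
Proof.
move=> tz gz; suff /(_ r (leqnn r)) :
  forall i, (i <= r)%N -> gen_subfield (fgen f (fun j => (i <= j)%N)) z by [].
elim=> [|i IH] ir.
  by apply: gen_mono gz => u [uc|[j _ uj]]; apply: mem_gen; [left|right; exists j].
(* Nothing bounds r by m; from m on there is no generator of index i to drop. *)
have [mi|im] := leqP m i.
  apply: gen_mono (IH (ltnW ir)) => u [uc|[j ij _]]; first by apply: mem_gen; left.
  by move: (ltn_ord j); rewrite ltnNge (leq_trans mi ij).
pose j := Ordinal im.
pose T := gen_subfield (fun u => varfield (fun k => (r <= k)%N) u
                              \/ fgen f (fun k => (i < k)%N) u).
apply: (@adjoin_transcendental L (gen_subfield (fgen f (fun k => (i < k)%N))) T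
  (tofrac (f j)) z (gen_subfieldP _) (gen_subfieldP _)).
- by move=> x; apply: gen_mono => u fu; apply: mem_gen; right.
- apply: triangular_transcendental => // x; apply: gen_mono => u [tu|fu].
    by apply: mem_gen; left.
  apply: mem_gen; right; case: fu => [uc|[k ik uk]]; [by left|right; exists k => //].
  by rewrite /= -val_eqE /= neq_ltn ik orbT.
- by apply: mem_gen; left.
apply: gen_mono (IH (ltnW ir)) => u [uc|[k ik ->]].
  by apply: mem_gen; left; apply: mem_gen; left.
have [<-|kj] := eqVneq j k; first by apply: mem_gen; right; rewrite mem_head.
apply: mem_gen; left; apply: mem_gen; right; exists k => //.
by rewrite ltn_neqAle ik andbT -val_eqE in kj *.
Qed.

End Triangular.
End Frobenius.

(** * The additive polynomials N_i *)

Section AdditivePolynomials.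
Variables (F : finFieldType) (n : nat) (W : vectType F) (Fl : nat -> {vspace W}).
Local Notation R := {mpoly F[n + n]}.
Implicit Types (c d : {ffun 'I_n -> F}).

Definition xform c : R := \sum_(k < n) c k *: xvar F k.

Lemma xformD c d : xform (c + d) = xform c + xform d.
Proof. by rewrite -big_split; apply: eq_bigr => k _; rewrite ffunE scalerDl. Qed.

Lemma xform_inj : injective xform.
Proof.
move=> c d cd; apply/ffunP => k.
have xc c' : (xform c')@_(U_(rshift n k)) = c' k.
  rewrite raddf_sum (bigD1 k) //= mcoeffZ mcoeffX eqxx mulr1 big1 ?addr0 // => j jk.
  rewrite mcoeffZ mcoeffX eq_mnm1.
  by rewrite (inj_eq (@rshift_inj n n)) (negPf jk) mulr0.
by rewrite -xc cd xc.
Qed.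

Lemma UtildeP i c :
  reflect (forall k : 'I_n, (k < flag_rank Fl i.-1)%N -> c k = 0) (c \in Utilde n Fl i).
Proof.
rewrite inE; apply: (iffP forallP) => cU k; last by apply/implyP => /cU->.
by move/(implyP (cU k))/eqP.
Qed.

Lemma Utilde0 i : (0 : {ffun 'I_n -> F}) \in Utilde n Fl i.
Proof. by apply/UtildeP => k _; rewrite ffunE. Qed.

Lemma UtildeD i c d : c \in Utilde n Fl i -> d \in Utilde n Fl i ->
  c + d \in Utilde n Fl i.
Proof.
by move=> /UtildeP cU /UtildeP dU; apply/UtildeP => k kr; rewrite ffunE cU ?dU ?addr0.
Qed.

Lemma UtildeN i c : c \in Utilde n Fl i -> - c \in Utilde n Fl i.
Proof. by move=> /UtildeP cU; apply/UtildeP => k kr; rewrite ffunE cU ?oppr0. Qed.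

(** That |U| is a power of q makes N commute with scalars and turns it into a Frobenius power when
    the x's are set to 0. *)
Lemma card_Utilde i : exists s, #|Utilde n Fl i| = (#|F| ^ s)%N.
Proof.
exists #|[pred k : 'I_n | ~~ (k < flag_rank Fl i.-1)%N]|.
rewrite -(card_pffun_on 0); apply: eq_card => c; rewrite inE /=.
apply/forallP/pffun_onP => [cU|[cU _] k].
  split=> [|x _ //]; apply/subsetP => k; rewrite !inE; apply: contra => kr.
  exact: (implyP (cU k)).
apply/implyP => kr; apply: contraT => ck.
by have := subsetP cU k; rewrite !inE kr => /(_ ck).
Qed.

Variable i : nat.
Local Notation U := (Utilde n Fl i).
Local Notation N := (Npoly Fl i).

Lemma NpolyE (t : R) : N t = \prod_(c in U) (t + xform c).
Proof. by []. Qed.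

Lemma Npoly_translate c (t : R) : c \in U -> N (t + xform c) = N t.
Proof.
move=> cU; rewrite !NpolyE [RHS](reindex_inj (addrI c)) /=.
apply: eq_big => d; last by rewrite xformD addrA.
apply/idP/idP => dU; first exact: UtildeD.
by rewrite -[d](addKr c) UtildeD ?UtildeN.
Qed.

Lemma Npoly0 : N 0 = 0 :> R.
Proof.
rewrite NpolyE (bigD1 (0 : {ffun 'I_n -> F})) ?Utilde0 //= add0r.
by rewrite /xform big1 ?mul0r // => k _; rewrite ffunE scale0r.
Qed.

Lemma Npoly_xform c : c \in U -> N (xform c) = 0.
Proof. by move=> cU; rewrite -[xform c]add0r Npoly_translate // Npoly0. Qed.

(* N(X + s) - N(X) - N(s) has degree less than |U| and vanishes on U. *)
Lemma NpolyD (t s : R) : N (t + s) = N t + N s.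
Proof.
pose Q (a : R) : {poly R} := \prod_(c <- enum U) ('X - (- (xform c + a))%:P).
have sizeQ a : size (Q a) = #|U|.+1 by rewrite size_prod_XsubC -cardE.
have QE a x : (Q a).[x] = N (x + a).
  rewrite horner_prod big_enum NpolyE; apply: eq_bigr => c _.
  by rewrite !hornerE opprK addrA addrAC.
have lcQ a : (Q a)`_#|U| = 1.
  have := monic_prod_XsubC (enum U) predT (fun c => - (xform c + a)).
  by rewrite -[\prod_(_ <- _) _]/(Q a) monicE lead_coefE sizeQ => /eqP.
clearbody Q.
have DE x : (Q s - Q 0 - (N s)%:P).[x] = N (x + s) - N x - N s.
  by rewrite !hornerD !hornerN !QE hornerC addr0.
have : Q s - Q 0 - (N s)%:P = 0.
  apply: (@roots_geq_poly_eq0 _ _ [seq xform c | c <- enum U]).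
  - apply/allP => _ /mapP[c + ->]; rewrite mem_enum => cU.
    rewrite rootE DE [_ + s]addrC Npoly_translate //.
    by rewrite Npoly_xform // subr0 subrr.
  - by rewrite map_inj_uniq ?enum_uniq //; apply: xform_inj.
  - rewrite size_map -cardE; apply/leq_sizeP => j jU.
    have U0 : (0 < #|U|)%N by apply/card_gt0P; exists 0; apply: Utilde0.
    rewrite !coefB coefC gtn_eqF ?(leq_trans U0) // subr0.
    case: ltngtP jU => // [jU|<-] _; last by rewrite !lcQ subrr.
    by rewrite !nth_default ?subrr // sizeQ.
move/(congr1 (fun p : {poly R} => p.[t])); rewrite DE horner0 => /eqP.
by rewrite subr_eq0 subr_eq => /eqP->; rewrite addrC.
Qed.

(** For nonzero a, scaling permutes U, so a factors out |U| times, and a^|U| = a. *)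
Lemma NpolyZ a (t : R) : N (a *: t) = a *: N t.
Proof.
have [->|a0] := eqVneq a 0; first by rewrite !scale0r Npoly0.
pose m c : {ffun 'I_n -> F} := [ffun k => a * c k].
have m_inj : injective m.
  move=> c d /ffunP cd; apply/ffunP => k; apply: (mulfI a0).
  by have := cd k; rewrite !ffunE.
rewrite !NpolyE (reindex_inj m_inj) /=.
under eq_bigl => c.
  have -> : (m c \in U) = (c \in U).
    apply/UtildeP/UtildeP => cU k /cU; rewrite ffunE; last by move->; rewrite mulr0.
    by move/eqP; rewrite mulf_eq0 (negPf a0) => /eqP.
  over.
have -> : \prod_(c in U) (a *: t + xform (m c)) = \prod_(c in U) (a *: (t + xform c)).
  apply: eq_bigr => c _; rewrite scalerDr; congr (_ + _).
  by rewrite scaler_sumr; apply: eq_bigr => k _; rewrite ffunE scalerA.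
rewrite scaler_prod prodr_const; have [s ->] := card_Utilde i.
by rewrite expf_card_pow.
Qed.

Lemma Npoly_sum (I : Type) (r : seq I) (a : I -> F) (t : I -> R) :
  N (\sum_(j <- r) a j *: t j) = \sum_(j <- r) a j *: N (t j).
Proof.
elim: r => [|j r IH]; first by rewrite !big_nil Npoly0.
by rewrite !big_cons NpolyD NpolyZ IH.
Qed.

Definition y_to_N : n.-tuple R := [tuple N (yvar F k) | k < n].

Lemma comp_y_to_NX k : 'X_k \mPo y_to_N = N (yvar F k).
Proof. by rewrite comp_mpolyXU -tnth_nth tnth_mktuple. Qed.

(* Setting the x's to 0 turns N(y_k) into a q-power of y_k. *)
Lemma comp_y_to_N_inj : injective (comp_mpoly y_to_N).
Proof.
apply: raddf_inj => p p0; have [s cardU] := card_Utilde i.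
suff : p ^+ (#|F| ^ s) = 0 by move/eqP; rewrite expf_eq0 => /andP[_ /eqP].
rewrite -comp_mpoly_card_pow.
pose x0 : (n + n).-tuple {mpoly F[n]} :=
  [tuple if split k is inl j then 'X_j else 0 | k < n + n].
have x0X k : 'X_k \mPo x0 = if split k is inl j then 'X_j else 0.
  by rewrite comp_mpolyXU -tnth_nth tnth_mktuple.
have -> : p \mPo [tuple 'X_i ^+ (#|F| ^ s) | i < n] = (p \mPo y_to_N) \mPo x0.
  rewrite -[RHS]/((comp_mpoly x0 \o comp_mpoly y_to_N) p).
  apply: mpoly_rmorph_eq => [c|k] /=; first by rewrite !comp_mpolyC.
  rewrite comp_mpolyXU -tnth_nth tnth_mktuple comp_y_to_NX NpolyE rmorph_prod /=.
  rewrite -cardU -prodr_const; apply: eq_bigr => c _.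
  rewrite comp_mpolyD x0X -[lshift n k]/(unsplit (inl k)) unsplitK.
  rewrite [xform c \mPo x0]raddf_sum /= big1 ?addr0 // => j _.
  by rewrite comp_mpolyZ x0X -[rshift n j]/(unsplit (inr j)) unsplitK scaler0.
by rewrite p0 comp_mpoly0.
Qed.

End AdditivePolynomials.

(** * The copy of F(W_2) in F(V) *)

Section EmbedW2.
Variables (F : finFieldType) (n : nat).

Lemma comp_xvar_inj :
  injective (fun p : {mpoly F[n]} => p \mPo [tuple xvar F k | k < n]).
Proof.
pose y0 : (n + n).-tuple {mpoly F[n]} :=
  [tuple if split k is inr j then 'X_j else 0 | k < n + n].
apply: (can_inj (g := comp_mpoly y0)) => p.
rewrite -[LHS]/((comp_mpoly y0 \o comp_mpoly [tuple xvar F k | k < n]) p).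
rewrite -[RHS]/((idfun : {rmorphism _ -> _}) p).
apply: mpoly_rmorph_eq => [c|k] /=; first by rewrite !comp_mpolyC.
rewrite comp_mpolyXU -tnth_nth tnth_mktuple comp_mpolyXU -tnth_nth tnth_mktuple.
by rewrite -[rshift n k]/(unsplit (inr k)) unsplitK.
Qed.

Definition embed2_rmorph : {rmorphism {fraction {mpoly F[n]}} -> _} :=
  @fmap_of _ _ (comp_mpoly [tuple xvar F k | k < n]) comp_xvar_inj.

Lemma embed2_tofrac p :
  embed2_rmorph (tofrac p) = tofrac (p \mPo [tuple xvar F k | k < n]).
Proof. exact: fmap_tofrac. Qed.

Lemma comp_xvarX k : 'X_k \mPo [tuple xvar F k | k < n] = xvar F k.
Proof. by rewrite comp_mpolyXU -tnth_nth tnth_mktuple. Qed.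

Lemma embed2_var k : embed2_rmorph (tofrac 'X_k) = tofrac (xvar F k).
Proof. by rewrite embed2_tofrac comp_xvarX. Qed.

Lemma embed2_const c : embed2_rmorph (tofrac c%:MP) = tofrac c%:MP.
Proof. by rewrite embed2_tofrac comp_mpolyC. Qed.

End EmbedW2.

(** * The gluing group *)

Section FlagCoordinates.
Variables (F : finFieldType) (W : vectType F) (n l : nat) (Fl : nat -> {vspace W}).
Hypotheses (hn : \dim {:W} = n) (hFl : is_flag l Fl).
Variable e : n.-tuple W.
Hypothesis he : flag_basis l Fl e.
Local Notation r := (flag_rank Fl).

Definition entry (g : W -> W) (k j : 'I_n) : F := coord e k (g e`_j).

Let e_basis : basis_of fullv e. Proof. by case: he. Qed.
Let e_free : free e. Proof. exact: basis_free e_basis. Qed.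

Lemma flag_rank_mono a b : (a <= b)%N -> (r a <= r b)%N.
Proof.
by move=> ab; rewrite /flag_rank (@big_cat_nat _ _ _ a.+1 1 b.+1) //= leq_addr.
Qed.

Lemma flag_rank_full : r l = n.
Proof. by rewrite (flag_rankE hFl) //; have [_ -> _] := hFl. Qed.

Lemma flag_rank_le i : (i <= l)%N -> (r i <= n)%N.
Proof. by move=> il; rewrite -flag_rank_full flag_rank_mono. Qed.

Lemma basis_in_flag i (j : 'I_n) : (i <= l)%N -> (j < r i)%N -> e`_j \in Fl i.
Proof.
move=> il ji; have [_ <-] // := he; apply: memv_span.
rewrite -(nth_take 0 ji); apply: mem_nth.
by rewrite size_take size_tuple; case: ifP.
Qed.

Lemma coord_in_flag i (k : 'I_n) v : (i <= l)%N -> (r i <= k)%N -> v \in Fl i ->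
  coord e k v = 0.
Proof.
move=> il ik; have [_ <-] // := he => /(subvP _ v) vk.
have : (<<take (r i) e>> <= lker (linfun (coord e k : W -> F^o)))%VS.
  apply/span_subvP => _ /(nthP 0)[j + <-]; rewrite size_take size_tuple => jr.
  have ji : (j < r i)%N.
    move: jr; case: ifP => // /negbT; rewrite -leqNgt => rn jn.
    exact: leq_trans jn rn.
  have jn : (j < n)%N := leq_ltn_trans (leq_trans (ltnW ji) ik) (ltn_ord k).
  rewrite nth_take // memv_ker lfunE /= -[j]/(nat_of_ord (Ordinal jn)) coord_free //.
  have jk : (j < k)%N by apply: leq_trans ji ik.
  by rewrite -val_eqE /= (ltn_eqF jk).
by move/vk; rewrite memv_ker lfunE => /eqP.
Qed.

Lemma flag_endo_entry (g : 'End(W)) i (k j : 'I_n) : g \in flag_endo l Fl ->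
  (i <= l)%N -> (r i <= k)%N -> (j < r i)%N -> entry g k j = 0.
Proof.
(* [flag_endo] constrains only the members [Fl i.+1]; at i = 0 no index j lies below r_0 = 0. *)
move=> /forallP gF; case: i => [|i] il ik ji; first by rewrite /flag_rank big_geq in ji.
apply: (coord_in_flag il ik); apply: (subvP (gF (Ordinal il))); apply: memv_img.
exact: basis_in_flag.
Qed.

Lemma entry_id k j : entry id k j = (k == j)%:R.
Proof. by rewrite eq_sym; apply: coord_free. Qed.

Lemma glue_basis_l (j : 'I_n) : (glue_basis e)`_(lshift n j) = (e`_j, 0).
Proof.
rewrite /= nth_cat size_map size_tuple ltn_ord.
by rewrite (nth_map 0) ?size_tuple.
Qed.

Lemma glue_basis_r (j : 'I_n) : (glue_basis e)`_(rshift n j) = (0, e`_j).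
Proof.
rewrite /= nth_cat size_map size_tuple ltnNge leq_addr /= addKn.
by rewrite (nth_map 0) ?size_tuple.
Qed.

Lemma glue_vecE (u v : W) : (u, v) = \sum_(i < n + n)
  (match split i with inl k => coord e k u | inr k => coord e k v end)
    *: (glue_basis e)`_i.
Proof.
rewrite big_split_ord /=.
under eq_bigr => k _ do
  rewrite -[lshift n k]/(unsplit (inl k)) unsplitK glue_basis_l.
under [X in _ = _ + X]eq_bigr => k _ do
  rewrite -[rshift n k]/(unsplit (inr k)) unsplitK glue_basis_r.
rewrite [in LHS](coord_basis e_basis (memvf u)) [in LHS](coord_basis e_basis (memvf v)).
apply: injective_projections => /=; rewrite !raddf_sum /=.
  by rewrite [X in _ = _ + X]big1 ?addr0 // => k _; rewrite scaler0.
by rewrite [X in _ = X + _]big1 ?add0r // => k _; rewrite scaler0.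
Qed.

Let ge_free : free (glue_basis e). Proof. exact: basis_free (glue_basisP e_basis). Qed.

Lemma coord_glue (u v : W) (i : 'I_(n + n)) : coord (glue_basis e) i (u, v) =
  match split i with inl k => coord e k u | inr k => coord e k v end.
Proof. by rewrite [in LHS](glue_vecE u v) coord_sum_free. Qed.

Lemma coord_glue_l u v k : coord (glue_basis e) (lshift n k) (u, v) = coord e k u.
Proof. by rewrite coord_glue -[lshift n k]/(unsplit (inl k)) unsplitK. Qed.

Lemma coord_glue_r u v k : coord (glue_basis e) (rshift n k) (u, v) = coord e k v.
Proof. by rewrite coord_glue -[rshift n k]/(unsplit (inr k)) unsplitK. Qed.

Lemma poly_act_x (t : glue_triple W) k :
  poly_act (glue_basis e) (glue_act t) (xvar F k) = \sum_j entry t.2 k j *: xvar F j.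
Proof.
rewrite poly_actX /pullback big_split_ord /= big1 ?add0r => [|j _].
  by apply: eq_bigr => j _; rewrite glue_basis_r /glue_act coord_glue_r.
by rewrite glue_basis_l /glue_act coord_glue_r /= linear0 linear0 scale0r.
Qed.

Lemma poly_act_y (t : glue_triple W) k :
  poly_act (glue_basis e) (glue_act t) (yvar F k) =
  \sum_j entry t.1.1 k j *: yvar F j + xform [ffun j => entry t.1.2 k j].
Proof.
rewrite poly_actX /pullback big_split_ord /=; congr (_ + _); apply: eq_bigr => j _.
  by rewrite glue_basis_l /glue_act coord_glue_l /= linear0 addr0.
by rewrite glue_basis_r /glue_act coord_glue_l /= linear0 add0r ffunE.
Qed.

Lemma poly_act_xform (t : glue_triple W) c :
  poly_act (glue_basis e) (glue_act t) (xform c) =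
  xform [ffun j => \sum_k c k * entry t.2 k j].
Proof.
rewrite rmorph_sum /=; under eq_bigr do rewrite poly_actZ poly_act_x scaler_sumr.
rewrite exchange_big; apply: eq_bigr => j _ /=.
by rewrite ffunE scaler_suml; apply: eq_bigr => k _; rewrite scalerA.
Qed.

Lemma xform_sum c k : (forall j, c j = (k == j)%:R) ->
  \sum_j c j *: yvar F j = yvar F k :> {mpoly F[n + n]}.
Proof.
move=> cE; rewrite (bigD1 k) //= cE eqxx scale1r big1 ?addr0 // => j jk.
by rewrite cE eq_sym (negPf jk) scale0r.
Qed.

End FlagCoordinates.

Section Gluing.
Variables (F : finFieldType) (n : nat) (W : vectType F).
Variables (l : nat) (Fl : nat -> {vspace W}) (e : n.-tuple W).
Variables (G1 G2 : {pred 'End(W)}).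
Hypotheses (hn : \dim {:W} = n) (hFl : is_flag l Fl) (he : flag_basis l Fl e).
Hypotheses (hG1 : is_GL_subgroup G1) (hP1 : {subset G1 <= parabolic l Fl}).
Hypotheses (hG2 : is_GL_subgroup G2) (hP2 : {subset G2 <= parabolic l Fl}).

Local Notation r := (flag_rank Fl).
Local Notation L := {fraction {mpoly F[n + n]}}.
Local Notation L1 := {fraction {mpoly F[n]}}.
Local Notation ge := (glue_basis e).

Hypothesis e_basis : basis_of fullv e.
Local Notation ge_basis := (glue_basisP e_basis).
Local Notation act := (frac_aut ge_basis).
Local Notation act1 := (frac_aut e_basis).
Local Notation glued := (gluing l Fl G1 G2).

Lemma glue_act_linear (t : glue_triple W) : linear (glue_act t).
Proof.
move=> a [u1 u2] [v1 v2]; apply: injective_projections; rewrite /= !linearP //.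
by rewrite scalerDr addrACA.
Qed.

Lemma glue_act_inj t : glued t -> injective (glue_act t).
Proof.
move=> gt; apply: (can_inj (g := glue_act (glue_inv t))) => w.
by rewrite -glue_actM (glue_mulV hG1 hG2 gt) glue_act1.
Qed.

Lemma End_inj (G : {pred 'End(W)}) g : is_GL_subgroup G -> g \in G ->
  injective (g : W -> W).
Proof. by move=> [GL _ _ _] /GL /lker0P. Qed.

Definition glue_auts : {set linear_aut (W * W)%type} :=
  auts_in (fun h => exists2 t, glued t & h = glue_act t).

Lemma glue_auts_group_set : group_set glue_auts.
Proof.
apply: auts_in_group_set => [|_ _ [s gs ->] [t gt ->]].
  exists (glue_one W); first exact: gluing1.
  by apply/funext => w; rewrite glue_act1.
exists (glue_mul s t); first exact: gluingM.
by apply/funext => w; rewrite glue_actM.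
Qed.
Canonical glue_auts_group := Group glue_auts_group_set.

Definition End_auts (G : {pred 'End(W)}) : {set linear_aut W} :=
  auts_in (fun h => exists2 g, g \in G & h = g :> (W -> W)).

Lemma End_auts_group_set (G : {pred 'End(W)}) :
  is_GL_subgroup G -> group_set (End_auts G).
Proof.
case=> _ G_1 G_M _; apply: auts_in_group_set => [|_ _ [g gG ->] [h hG ->]].
  by exists \1%VF => //; apply/funext => w; rewrite id_lfunE.
by exists (g \o h)%VF; [apply: G_M|apply/funext => w; rewrite comp_lfunE].
Qed.

Lemma glue_inv_fieldE z :
  inv_field ge glued (@glue_act F W) z <-> fixed_by act glue_auts z.
Proof.
apply: inv_fieldE => t gt; split; [exact: glue_act_linear|exact: glue_act_inj].
Qed.

Lemma End_inv_fieldE (G : {pred 'End(W)}) z : is_GL_subgroup G ->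
  inv_field e (fun g => g \in G) (fun g : 'End(W) => g : W -> W) z <->
  fixed_by act1 (End_auts G) z.
Proof.
move=> hG; apply: inv_fieldE => g gG; split; last exact: End_inj gG.
exact: linearP.
Qed.

Lemma glue_aut t : glued t -> exists2 s, s \in glue_auts & aut_fun s = glue_act t.
Proof.
move=> gt; have [s st] := aut_exists (@glue_act_linear t) (glue_act_inj gt).
by exists s => //; apply/auts_inP; exists t.
Qed.

Lemma End_aut (G : {pred 'End(W)}) (g : 'End(W)) : is_GL_subgroup G -> g \in G ->
  exists2 s, s \in End_auts G & aut_fun s = g.
Proof.
move=> hG gG; have gl : linear (g : W -> W) by exact: linearP.
have [s sg] := aut_exists gl (End_inj hG gG).
by exists s => //; apply/auts_inP; exists g.
Qed.

Lemma entry0_1 g i (k j : 'I_n) : g \in G1 -> (i <= l)%N -> (r i <= k)%N ->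
  (j < r i)%N -> entry e g k j = 0.
Proof. by move=> /hP1/parabolic_endo; apply: flag_endo_entry. Qed.

Lemma entry0_2 g i (k j : 'I_n) : g \in G2 -> (i <= l)%N -> (r i <= k)%N ->
  (j < r i)%N -> entry e g k j = 0.
Proof. by move=> /hP2/parabolic_endo; apply: flag_endo_entry. Qed.

Lemma entry0_phi t i (k j : 'I_n) : glued t -> (i <= l)%N -> (r i <= k)%N ->
  (j < r i)%N -> entry e t.1.2 k j = 0.
Proof. by case=> _ + _; apply: flag_endo_entry. Qed.

Lemma poly_act_glue_inj t : glued t -> injective (poly_act ge (glue_act t)).
Proof. by case/glue_aut=> s _ <-; apply: (poly_act_aut_inj ge_basis). Qed.

(** The elements of G_2 are block triangular, so they permute the forms of U~_(i+1), and with them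
    the factors of N. *)
Lemma poly_act_Npoly t i (p : {mpoly F[n + n]}) : glued t -> (i <= l)%N ->
  poly_act ge (glue_act t) (Npoly Fl i.+1 p) = Npoly Fl i.+1 (poly_act ge (glue_act t) p).
Proof.
move=> gt il; pose U := Utilde n Fl i.+1.
pose m (c : {ffun 'I_n -> F}) : {ffun 'I_n -> F} :=
  [ffun j => \sum_k c k * entry e t.2 k j].
have xm c : poly_act ge (glue_act t) (xform c) = xform (m c).
  exact: poly_act_xform he _ _.
have m_inj : injective m.
  by move=> c d cd; apply: xform_inj; apply: (poly_act_glue_inj gt); rewrite !xm cd.
have mU : [set m c | c in U] = U.
  apply/eqP; rewrite eqEcard card_imset // leqnn andbT.
  apply/subsetP => _ /imsetP[c cU ->].
  apply/UtildeP => j /= jr; rewrite ffunE big1 // => k _.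
  have [kr|rk] := ltnP k (r i).
    by move/UtildeP: cU => /(_ k kr) ->; rewrite mul0r.
  by have [_ _ g2] := gt; rewrite (entry0_2 g2 il rk jr) mulr0.
rewrite NpolyE rmorph_prod /= NpolyE -[in RHS]/U -mU big_imset /=; last exact: in2W.
by apply: eq_bigr => c _; rewrite rmorphD /= xm.
Qed.

(** All variables are replaced, also those with k < r_i, which gives an injective morphism on the
    whole of F(W_1); only its restriction to [tail1 i] is equivariant. *)
Definition theta i : {rmorphism L1 -> L} :=
  fmap_of (@comp_y_to_N_inj F n W Fl i.+1).

Lemma theta_tofrac i p : theta i (tofrac p) = tofrac (p \mPo y_to_N n Fl i.+1).
Proof. exact: fmap_tofrac. Qed.

Lemma theta_var i k : theta i (tofrac 'X_k) = tofrac (Npoly Fl i.+1 (yvar F k)).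
Proof. by rewrite theta_tofrac comp_y_to_NX. Qed.

Lemma theta_const i c : theta i (tofrac c%:MP) = tofrac c%:MP.
Proof. by rewrite theta_tofrac comp_mpolyC. Qed.

Definition tail1 i := varfield (F := F) (fun k : 'I_n => (r i <= k)%N).

(* The variable x_j has index n + j >= r i, so tail i is F(x, y_k : k >= r i). *)
Definition tail i := varfield (F := F) (fun k : 'I_(n + n) => (r i <= k)%N).

Lemma act_tofrac s p : act s (tofrac p) = tofrac (poly_act ge (aut_fun s) p).
Proof. exact: frac_aut_tofrac. Qed.

(** For k >= r_i the contribution of phi to y_k is a form of U~_(i+1), which N kills; what remains
    is the action of g_1, through which N passes by linearity. *)
Lemma theta_equiv i t s s1 a : (i <= l)%N -> glued t ->
    aut_fun s = glue_act t -> aut_fun s1 = t.1.1 -> tail1 i a ->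
  act s (theta i a) = theta i (act1 s1 a).
Proof.
move=> il gt st s1t.
apply: (varfield_eq (h1 := act s \o theta i) (h2 := theta i \o act1 s1)).
  by move=> c /=; rewrite frac_aut_const !theta_const frac_aut_const.
move=> k rk /=; rewrite theta_var act_tofrac st poly_act_Npoly //.
rewrite (poly_act_y he) frac_aut_tofrac poly_actX s1t theta_tofrac.
rewrite NpolyD Npoly_xform ?addr0.
  congr tofrac; rewrite Npoly_sum /pullback raddf_sum; apply: eq_bigr => j _ /=.
  by rewrite comp_mpolyZ comp_y_to_NX.
by apply/UtildeP => j /= jr; rewrite ffunE (entry0_phi gt il rk jr).
Qed.

Lemma tail_ring i : is_subring (tail i).
Proof. exact: varfield_ring. Qed.

Lemma tailZ i c p : tail i (tofrac p) -> tail i (tofrac (c *: p)).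
Proof.
move=> tp; rewrite -mul_mpolyC tofracM; apply: (subringM (tail_ring i)) => //.
exact: varfield_const.
Qed.

Lemma tail_y i (k : 'I_n) : (r i <= k)%N -> tail i (tofrac (yvar F k)).
Proof. by move=> ik; apply: varfield_var. Qed.

Lemma tail_x i k : (i <= l)%N -> tail i (tofrac (xvar F k)).
Proof.
move=> il; apply: varfield_var => /=.
by rewrite (leq_trans (flag_rank_le hn hFl il)) // leq_addr.
Qed.

Lemma tail_xform i c : (i <= l)%N -> tail i (tofrac (xform c)).
Proof.
move=> il; rewrite rmorph_sum; apply: (subring_sum (tail_ring i)) => k _ /=.
by apply: tailZ; apply: tail_x.
Qed.

Lemma tail_Npoly i j (k : 'I_n) : (i <= l)%N -> (r i <= k)%N ->
  tail i (tofrac (Npoly Fl j (yvar F k))).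
Proof.
move=> il ik; rewrite NpolyE rmorph_prod.
apply: (subring_prod (tail_ring i)) => c _ /=; rewrite tofracD.
by apply: (subringD (tail_ring i)); [apply: tail_y|apply: tail_xform].
Qed.

Lemma theta_tail1 i j a : (i <= l)%N -> tail1 i a -> tail i (theta j a).
Proof.
move=> il; apply: varfield_stable => [|c|k ik]; first exact: varfieldP.
  by rewrite theta_const; apply: varfield_const.
by rewrite theta_var; apply: tail_Npoly.
Qed.

Lemma tail_stable i : (i <= l)%N -> stable_under act glue_auts (tail i).
Proof.
move=> il s z /auts_inP[t gt st].
apply: varfield_stable => [|c|k]; first exact: varfieldP.
  by rewrite frac_aut_const; apply: varfield_const.
have rT := tail_ring i.
rewrite act_tofrac st -[k]splitK; case: (split k) => {}k /= ik.
  rewrite (poly_act_y he) tofracD; apply: (subringD rT); last exact: tail_xform.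
  rewrite rmorph_sum; apply: (subring_sum rT) => j _ /=.
  have [ji|ij] := ltnP j (r i); last by apply: tailZ; apply: tail_y.
  have [g1 _ _] := gt.
  by rewrite (entry0_1 g1 il ik ji) scale0r tofrac0; apply: subring0.
rewrite (poly_act_x he) rmorph_sum; apply: (subring_sum rT) => j _ /=.
by apply: tailZ; apply: tail_x.
Qed.

Lemma tail1_stable i : (i <= l)%N -> stable_under act1 (End_auts G1) (tail1 i).
Proof.
move=> il s z /auts_inP[g gG sg].
apply: varfield_stable => [|c|k ik]; first exact: varfieldP.
  by rewrite frac_aut_const; apply: varfield_const.
have rT : is_subring (tail1 i) by apply: varfield_ring.
rewrite frac_aut_tofrac sg poly_actX rmorph_sum; apply: (subring_sum rT) => j _ /=.
have [ji|ij] := ltnP j (r i).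
  rewrite -[coord _ _ _]/(entry e g k j) (entry0_1 gG il ik ji) scale0r tofrac0.
  exact: subring0.
rewrite -mul_mpolyC tofracM; apply: (subringM rT); first exact: varfield_const.
exact: varfield_var.
Qed.

Lemma embed2_equiv t s s2 v : aut_fun s = glue_act t -> aut_fun s2 = t.2 ->
  act s (embed2_rmorph F n v) = embed2_rmorph F n (act1 s2 v).
Proof.
move=> st s2t.
apply: (varfield_eq (P := predT) (h1 := act s \o embed2_rmorph F n)
  (h2 := embed2_rmorph F n \o act1 s2)); last exact: varfieldT.
  by move=> c /=; rewrite frac_aut_const !embed2_const frac_aut_const.
move=> k _ /=; rewrite embed2_var act_tofrac st (poly_act_x he).
rewrite frac_aut_tofrac poly_actX s2t embed2_tofrac; congr tofrac.
rewrite /pullback raddf_sum; apply: eq_bigr => j _ /=.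
by rewrite comp_mpolyZ comp_xvarX.
Qed.

(** * Descent along the flag *)

(** The tensor of the form c with e_k: glued between identities, it translates y_k by c and fixes
    every other variable. *)
Definition rank_one (k : 'I_n) (c : {ffun 'I_n -> F}) (w : W) : W :=
  (\sum_j c j * coord e j w) *: e`_k.

Fact rank_one_linear k c : linear (rank_one k c).
Proof.
move=> a u v; rewrite /rank_one scalerA -scalerDl mulr_sumr -big_split /=.
by congr (_ *: _); apply: eq_bigr => j _; rewrite linearP mulrDr mulrCA.
Qed.

HB.instance Definition _ k c := GRing.isLinear.Build F W W _ _ (rank_one_linear k c).

Definition transl_triple k c : glue_triple W := (\1%VF, linfun (rank_one k c), \1%VF).

(** A member of the flag that does not contain e_k is contained in F_i, because k < r_(i+1), and c
    vanishes on F_i. *)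
Lemma transl_glued i (k : 'I_n) c :
    (i < l)%N -> (k < r i.+1)%N -> c \in Utilde n Fl i.+1 ->
  glued (transl_triple k c).
Proof.
move=> il ki /UtildeP cU; have [_ G1_1 _ _] := hG1; have [_ G2_1 _ _] := hG2.
split=> //=; apply/forallP => i'; apply/subvP => _ /memv_imgP[v vF ->].
rewrite lfunE /= /rank_one; have [ki'|i'k] := ltnP k (r i'.+1).
  by apply: memvZ; apply: (basis_in_flag he _ ki').
rewrite big1 ?scale0r ?mem0v // => j _; have [ji|ij] := ltnP j (r i).
  by rewrite cU ?mul0r.
rewrite (coord_in_flag he _ _ vF) ?mulr0 //; apply: leq_trans ij.
apply: flag_rank_mono; rewrite -ltnS ltnNge; apply/negP => ii'.
by have := leq_ltn_trans (leq_trans (flag_rank_mono Fl ii') i'k) ki; rewrite ltnn.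
Qed.

Definition translations i k : {set linear_aut (W * W)%type} :=
  auts_in (fun h => exists2 c, c \in Utilde n Fl i.+1 & h = glue_act (transl_triple k c)).

Lemma transl_tripleD k c d :
  glue_act (transl_triple k c) \o glue_act (transl_triple k d)
    = glue_act (transl_triple k (c + d)).
Proof.
apply/funext => w; rewrite /glue_act /= !id_lfunE !lfunE /= /rank_one.
congr (_, _); rewrite -addrA -scalerDl -big_split; congr (_ + _ *: _).
by apply: eq_bigr => j _; rewrite ffunE /= mulrDl addrC.
Qed.

Lemma translations_group_set i k : group_set (translations i k).
Proof.
apply: auts_in_group_set => [|_ _ [c cU ->] [d dU ->]].
  exists 0; first exact: Utilde0.
  apply/funext => -[u v]; rewrite /glue_act /= !id_lfunE lfunE /= /rank_one.
  by rewrite big1 ?scale0r ?addr0 // => j _; rewrite ffunE mul0r.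
by exists (c + d); [apply: UtildeD|rewrite transl_tripleD].
Qed.
Canonical translations_group i k := Group (translations_group_set i k).

Lemma entry_1 k j : entry e (\1%VF : 'End(W)) k j = (k == j)%:R.
Proof. by rewrite -(entry_id he) /entry id_lfunE. Qed.

Lemma act_transl_x s k c j : aut_fun s = glue_act (transl_triple k c) ->
  act s (tofrac (xvar F j)) = tofrac (xvar F j).
Proof.
move=> st; rewrite act_tofrac st (poly_act_x he) (bigD1 j) //= big1 => [|j' jj'].
  by rewrite entry_1 eqxx scale1r addr0.
by rewrite entry_1 eq_sym (negPf jj') scale0r.
Qed.

Lemma act_transl_y s k c j : aut_fun s = glue_act (transl_triple k c) ->
  act s (tofrac (yvar F j)) =
  if j == k then tofrac (yvar F j) + tofrac (xform c) else tofrac (yvar F j).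
Proof.
move=> st; rewrite act_tofrac st (poly_act_y he) (xform_sum (entry_1 j)).
have coordE (j1 j2 : 'I_n) : coord e j1 e`_j2 = (j1 == j2)%:R by rewrite -(entry_id he).
have -> : [ffun j' => entry e (transl_triple k c).1.2 j j'] = if j == k then c else 0.
  apply/ffunP => j'; rewrite ffunE /entry /= lfunE /= /rank_one linearZ /= coordE.
  rewrite (bigD1 j') //= coordE eqxx mulr1 big1 ?addr0 => [|j1 jj1]; last first.
    by rewrite coordE (negPf jj1) mulr0.
  by case: eqP => _; rewrite ?mulr1 ?mulr0 ?ffunE.
rewrite tofracD; case: eqP => // _.
by rewrite /xform big1 ?tofrac0 ?addr0 // => j' _; rewrite ffunE scale0r.
Qed.

Lemma act_transl_Npoly s i (k : 'I_n) c j : (i < l)%N -> (k < r i.+1)%N ->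
    c \in Utilde n Fl i.+1 -> aut_fun s = glue_act (transl_triple k c) ->
  act s (tofrac (Npoly Fl i.+1 (yvar F j))) = tofrac (Npoly Fl i.+1 (yvar F j)).
Proof.
move=> il ki cU st; have gt := transl_glued il ki cU.
rewrite act_tofrac st (poly_act_Npoly _ gt (ltnW il)) -st.
have /eqP := act_transl_y j st; rewrite act_tofrac; case: ifP => _.
  by rewrite -tofracD tofrac_eq => /eqP->; rewrite Npoly_translate.
by rewrite tofrac_eq => /eqP->.
Qed.

Lemma translations_sub i (k : 'I_n) : (i < l)%N -> (k < r i.+1)%N ->
  {subset translations i k <= glue_auts}.
Proof.
move=> il ki s /auts_inP[c cU st]; apply/auts_inP; exists (transl_triple k c) => //.
exact: transl_glued il ki cU.
Qed.

Lemma adjoin_translations i (k : 'I_n) (E : L -> Prop) z : (i < l)%N -> (k < r i.+1)%N ->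
    is_subfield E -> (forall c, c \in Utilde n Fl i.+1 -> E (tofrac (xform c))) ->
    (forall x, E x -> fixed_by act (translations i k) x) ->
    adjoin E [:: tofrac (yvar F k)] z -> fixed_by act glue_auts z ->
  adjoin E [:: tofrac (Npoly Fl i.+1 (yvar F k))] z.
Proof.
move=> il ki sE EU ET Ez Gz; pose U := Utilde n Fl i.+1.
pose us : seq L := [seq tofrac (xform c) | c <- enum U].
have DN : tofrac (Npoly Fl i.+1 (yvar F k)) = \prod_(u <- us) (tofrac (yvar F k) + u).
  rewrite big_map big_enum NpolyE rmorph_prod; apply: eq_bigr => c _ /=.
  by rewrite tofracD.
rewrite DN; apply: (fixed_gen_translations (frac_aut1 ge_basis) (frac_autM ge_basis)
  (G := translations_group i k) sE ET) => //.
- rewrite map_inj_uniq ?enum_uniq // => c d /eqP; rewrite tofrac_eq => /eqP.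
  exact: xform_inj.
- by rewrite size_map -cardE; apply/card_gt0P; exists 0; apply: Utilde0.
- by move=> _ /mapP[c + ->]; rewrite mem_enum; apply: EU.
- move=> _ /mapP[c + ->]; rewrite mem_enum => cU.
  have [s _ st] := glue_aut (transl_glued il ki cU).
  exists s; first by apply/auts_inP; exists c.
  by rewrite (act_transl_y k st) eqxx.
- move=> s /auts_inP[c cU st]; rewrite (act_transl_y k st) eqxx addrAC subrr add0r.
  exact: EU.
- by move=> s /auts_inP[c cU st]; rewrite -DN (act_transl_Npoly k il ki cU st).
- by move=> s /(translations_sub il ki); apply: Gz.
Qed.

(* The generators y_k of the block are replaced by N(y_k) one at a time. *)
Lemma translation_descent i z : (i < l)%N -> tail i z -> fixed_by act glue_auts z ->
  gen_subfield (fun u => tail i.+1 u \/ exists2 k : 'I_n,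
     (r i <= k < r i.+1)%N & u = tofrac (Npoly Fl i.+1 (yvar F k))) z.
Proof.
move=> il tz Gz.
pose gen1 m (k : 'I_n) : L :=
  tofrac (if (k < m)%N then Npoly Fl i.+1 (yvar F k) else yvar F k).
pose B m := gen_subfield (fun u => tail i.+1 u \/ exists2 k : 'I_n,
     (r i <= k < r i.+1)%N & u = gen1 m k).
have B0 : B (r i) z.
  move: z tz {Gz}; apply: (gen_min (gen_subfieldP _)) => u [[c ->]|[k ik ->]].
    by apply: mem_gen; left; apply: varfield_const.
  have [ki|ik1] := ltnP k (r i.+1); last first.
    by apply: mem_gen; left; apply: varfield_var.
  have kn : (k < n)%N by apply: leq_trans ki (flag_rank_le hn hFl il).
  apply: mem_gen; right; exists (Ordinal kn); first by rewrite /= ik.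
  rewrite /gen1 /= ltnNge ik /= /yvar; congr (tofrac 'X_ _); exact: val_inj.
suff H d : (r i + d <= r i.+1)%N -> B (r i + d)%N z.
  have r_le := flag_rank_mono Fl (leqnSn i).
  have := H (r i.+1 - r i)%N; rewrite subnKC // => /(_ (leqnn _)).
  apply: gen_mono => u [tu|[k /andP[ik ki] ->]]; apply: mem_gen; first by left.
  by right; exists k; rewrite /gen1 ?ik ki.
elim: d => [|d IH]; first by rewrite addn0.
rewrite addnS => ki; have {IH}Bz := IH (ltnW ki).
set m := (r i + d)%N in ki Bz *.
have mn : (m < n)%N by apply: leq_trans ki (flag_rank_le hn hFl il).
pose k0 : 'I_n := Ordinal mn.
(* All generators except the one of index k0: the translations of y_(k0) fix this field pointwise,
   as [adjoin_translations] requires. *)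
pose E := gen_subfield (fun u => tail i.+1 u \/ exists2 k : 'I_n,
     (r i <= k < r i.+1)%N && (k != k0) & u = gen1 m k).
have Ez : adjoin E [:: tofrac (yvar F k0)] z.
  apply: gen_mono Bz => u [tu|[k ik ->]].
    by apply: mem_gen; left; apply: mem_gen; left.
  have [->|kk0] := eqVneq k k0.
    by apply: mem_gen; right; rewrite /gen1 ltnn mem_head.
  by apply: mem_gen; left; apply: mem_gen; right; exists k; rewrite ?ik.
have := @adjoin_translations i k0 E z il ki (gen_subfieldP _) _ _ Ez Gz.
have EU c : E (tofrac (xform c)) by apply: mem_gen; left; apply: tail_xform.
have ET x : E x -> fixed_by act (translations i k0) x.
  apply: gen_min => [|{}x]; first exact: fixed_subfield.
  case=> [tx|[k /andP[ik kk0] ->]] s /auts_inP[c cU st]; last first.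
    rewrite /gen1; case: ifP => _; first exact: act_transl_Npoly st.
    by rewrite (act_transl_y k st) (negPf kk0).
  apply: (@varfield_eq F _ _ _ (act s) idfun) tx => [c' /=|k /=].
    exact: frac_aut_const.
  rewrite -[k]splitK; case: (split k) => {}k /= ik; last exact: act_transl_x st.
  rewrite (act_transl_y k st); case: eqP ik => // -> /=.
  by rewrite leqNgt ki.
move/(_ (fun c _ => EU c) ET).
apply: (gen_min (S := B m.+1)) => [|u [|]]; first exact: gen_subfieldP.
  apply: gen_mono => {}u [tu|[k /andP[ik kk0] ->]]; first by apply: mem_gen; left.
  apply: mem_gen; right; exists k => //; rewrite /gen1 ltnS [in RHS]leq_eqVlt.
  by case: eqP => // km; case/eqP: kk0; apply: val_inj.
rewrite inE => /eqP->; apply: mem_gen; right; exists k0; rewrite ?ki ?leq_addr //=.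
by rewrite /gen1 ltnSn.
Qed.

(** * Bringing in the generators of the invariants of G_1 *)

Variable f : 'I_n -> {mpoly F[n]}.
Hypothesis hf_flag : flag_consistent l Fl f.
Hypothesis hf_gen : forall z : L1,
  fixed_by act1 (End_auts G1) z <-> gen_subfield (fgen f predT) z.

Lemma mpoly_from_tail1 i p : mpoly_from (r i) p -> tail1 i (tofrac p).
Proof.
move=> fp; apply: tofrac_varfield => mm k mp mk; rewrite leqNgt.
by apply: contra mk => ki; rewrite (fp mm mp k ki).
Qed.

Lemma block_of (j : 'I_n) : exists i, in_block l Fl i j.
Proof. by apply: (in_block_ex hFl); rewrite hn ltn_ord. Qed.

Lemma f_tail1 i (j : 'I_n) : (r i <= j)%N -> tail1 i (tofrac (f j)).
Proof.
have [i' i'j] := block_of j => ij; have := mpoly_from_tail1 (hf_flag i'j).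
apply: varfield_sub => k; apply: leq_trans; apply: flag_rank_mono.
case/and3P: i'j => _ _ ji'; rewrite -ltnS ltnNge; apply/negP => /(flag_rank_mono Fl) i'i.
by have := leq_trans ji' (leq_trans i'i ij); rewrite ltnn.
Qed.

Lemma f_fixed j : fixed_by act1 (End_auts G1) (tofrac (f j)).
Proof. by apply/hf_gen; apply: mem_gen; right; exists j. Qed.

Lemma f_algebraic z : algebraic_over (gen_subfield (fgen f predT)) z.
Proof.
have gG1 := End_auts_group_set hG1.
have [p [p0 Gp pz]] := fixed_algebraic (frac_aut1 e_basis) (frac_autM e_basis)
  (Group gG1) z.
by exists p; split=> // i; apply/hf_gen; apply: Gp.
Qed.

(** The two substitutions differ only at y_k with k < r_i, and these variables do not occur in
    f_j. *)
Lemma tilde_theta i (j : 'I_n) : in_block l Fl i j ->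
  tofrac (tilde_at Fl i (f j)) = theta i (tofrac (f j)).
Proof.
move=> ij; rewrite theta_tofrac; congr tofrac.
rewrite /tilde_at !comp_mpolyE; apply: eq_big_seq => mm mf; congr (_ *: _).
apply: eq_bigr => k _; rewrite !tnth_mktuple; case: leqP => // ki.
by rewrite (hf_flag ij mf ki) !expr0.
Qed.

Lemma theta_f_fixed i (j : 'I_n) : in_block l Fl i j ->
  fixed_by act glue_auts (theta i (tofrac (f j))).
Proof.
case/and3P=> il ij _ s /auts_inP[t gt st]; have [g1 _ _] := gt.
have [s1 s1G s1t] := End_aut hG1 g1.
by rewrite (theta_equiv (ltnW il) gt st s1t (f_tail1 ij)) f_fixed.
Qed.

Definition tilde_block i (u : L) : Prop :=
  exists2 j : 'I_n, in_block l Fl i j & u = theta i (tofrac (f j)).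

(* By translation_descent z lies in the compositum of tail i.+1 and theta (tail1 i).
   The stabilizer K0 of tail i.+1 reduces the second factor to its K0-invariants;
   these come from the invariants in F(W_1) of the stabilizer of tail1 i.+1 in G1,
   which are generated by tail1 i.+1 and the f_j with j >= r i. *)
Lemma level_descent i z : (i < l)%N -> tail i z -> fixed_by act glue_auts z ->
  gen_subfield (fun u => tail i.+1 u \/ tilde_block i u) z.
Proof.
move=> il tz Gz; have li := ltnW il.
have gG1 := End_auts_group_set hG1; pose H1 := Group gG1.
pose R (w : L) := exists2 a, tail1 i a & w = theta i a.
have sR : is_subfield R by apply: is_subfield_im; apply: varfieldP.
have stR : stable_under act glue_auts R.
  move=> s _ sG [a ta ->]; have /auts_inP[t gt st] := sG; have [g1 _ _] := gt.
  have [s1 s1G s1t] := End_aut hG1 g1.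
  exists (act1 s1 a); last exact: theta_equiv s1t ta.
  exact: tail1_stable.
pose K0 := stabilizer_group (frac_aut1 ge_basis) (frac_autM ge_basis)
  glue_auts_group (tail i.+1).
have K0G s : s \in K0 -> s \in glue_auts by case/stabilizerP.
have Rz : gen_subfield (fun u => R u \/ tail i.+1 u) z.
  apply: gen_mono (translation_descent il tz Gz) => u [tu|[k /andP[ik _] ->]].
    by apply: mem_gen; right.
  apply: mem_gen; left; exists (tofrac 'X_k); last by rewrite theta_var.
  exact: varfield_var.
have tK x : tail i.+1 x -> fixed_by act K0 x by move=> tx; apply: fixed_stabilizer.
have {Rz} := fixed_gen_adjoin (frac_aut1 ge_basis) (frac_autM ge_basis) (G := K0)
  sR (fun s w sK => stR s w (K0G s sK)) tK Rz (fun s sK => Gz s (K0G s sK)).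
apply: gen_mono => w [[[a ta ->] Kw]|tw]; last by apply: mem_gen; left.
pose K1 := stabilizer_group (frac_aut1 e_basis) (frac_autM e_basis) H1
  (tail1 i.+1).
(* An element g of [K1] lifts to (g, 0, 1), which lies in [K0]; equivariance and injectivity of
   [theta i] then carry the invariance of [theta i a] back to a. *)
have Ka : fixed_by act1 K1 a.
  move=> s1 /stabilizerP[/auts_inP[g gG s1g] s1tail].
  have gt : glued (g, 0, \1%VF).
    by split=> //=; [apply/forallP => i'; rewrite lim0g sub0v|case: hG2].
  have [s sG st] := glue_aut gt.
  apply: (fmorph_inj (theta i)); rewrite -(theta_equiv li gt st s1g ta); apply: Kw.
  apply/stabilizerP; split=> // x.
  apply: (@varfield_eq F _ _ _ (act s) idfun) => [c /=|k /=]; first exact: frac_aut_const.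
  rewrite -[k]splitK; case: (split k) => {}k /= ik; rewrite act_tofrac st.
    rewrite (poly_act_y he) /= [xform _]big1 ?addr0 => [|j _]; last first.
      by rewrite ffunE /entry lfunE /= linear0 scale0r.
    have /eqP := s1tail _ (varfield_var (F := F) ik).
    rewrite frac_aut_tofrac tofrac_eq poly_actX s1g => /eqP gk; congr tofrac.
    have := congr1 (comp_mpoly [tuple yvar F j | j < n]) gk.
    have yX j : 'X_j \mPo [tuple yvar F j | j < n] = yvar F j.
      by rewrite comp_mpolyXU -tnth_nth tnth_mktuple.
    rewrite yX /pullback raddf_sum /= => yk; rewrite -[RHS]yk; apply: eq_bigr => j _.
    by rewrite comp_mpolyZ yX.
  rewrite (poly_act_x he) /= (bigD1 k) //= big1 => [|j jk].
    by rewrite entry_1 eqxx scale1r addr0.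
  by rewrite entry_1 eq_sym (negPf jk) scale0r.
have s1T : is_subfield (tail1 i.+1) by apply: varfieldP.
have T1T x : tail1 i.+1 x -> tail1 i x.
  apply: varfield_sub => k; apply: leq_trans.
  exact: flag_rank_mono.
have rT : is_subring (tail1 i) by apply: varfield_ring.
have := fixed_descent (G := H1)
  s1T (tail1_stable il) rT (tail1_stable li) T1T ta Ka.
apply: gen_rmorph => [|b [tb|[tb Gb]]]; first exact: gen_subfieldP.
  by apply: mem_gen; left; apply: theta_tail1.
have /(triangular_descent (r := r i) _ f_algebraic tb) : gen_subfield (fgen f predT) b.
  exact/hf_gen.
move=> /(_ (fun j => @f_tail1 i j)).
apply: gen_rmorph => [|_ [[c ->]|[j ij ->]]]; first exact: gen_subfieldP.
  by apply: mem_gen; left; rewrite theta_const; apply: varfield_const.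
(* For j beyond block i, [theta i] does not produce f~_j, but its value already lies in
   [tail i.+1]. *)
have [ji|ij1] := ltnP j (r i.+1).
  by apply: mem_gen; right; exists j => //; rewrite /in_block il ij ji.
by apply: mem_gen; left; apply: theta_tail1 => //; apply: f_tail1.
Qed.

(** The constants enter through the second clause, since G_2 fixes them. *)
Definition glue_gens (u : L) : Prop :=
  (exists i, tilde_block i u) \/
  exists2 v, fixed_by act1 (End_auts G2) v & u = embed2_rmorph F n v.

Lemma tail_last z : tail l z -> fixed_by act glue_auts z ->
  exists2 v, fixed_by act1 (End_auts G2) v & z = embed2_rmorph F n v.
Proof.
move=> tz Gz.
have [v _ Dz] : exists2 v, True & z = embed2_rmorph F n v.
  apply: (@varfield_stable F _ _ L
    (fun w => exists2 v, True & w = embed2_rmorph F n v) idfun) tz => [|c|k /=].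
  - exact: (@is_subfield_im _ _ (embed2_rmorph F n) (fun=> True)).
  - by exists (tofrac c%:MP); rewrite ?embed2_const.
  rewrite (flag_rank_full hn hFl) -[k]splitK; case: (split k) => {}k /= nk.
    by have := leq_trans (ltn_ord k) nk; rewrite ltnn.
  by exists (tofrac 'X_k); rewrite ?embed2_var.
exists v => // s2 /auts_inP[g gG s2g].
(* Every g in G_2 lifts to (1, 0, g), so invariance under the glued group forces invariance of v
   under G_2. *)
have gt : glued (\1%VF, 0, g).
  by split=> //=; [case: hG1|apply/forallP => i'; rewrite lim0g sub0v].
have [s sG st] := glue_aut gt.
apply: (fmorph_inj (embed2_rmorph F n)); rewrite -(embed2_equiv _ st s2g) -Dz.
exact: Gz.
Qed.

Lemma glue_gens_fixed z : gen_subfield glue_gens z -> fixed_by act glue_auts z.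
Proof.
apply: gen_min => [|u]; first exact: fixed_subfield.
case=> [[i [j ij ->]]|[v Gv ->]]; first exact: theta_f_fixed.
move=> s /auts_inP[t gt st]; have [_ _ g2] := gt; have [s2 s2G s2t] := End_aut hG2 g2.
by rewrite (embed2_equiv _ st s2t) Gv.
Qed.

Lemma tail_fixed_gen d i z : (i + d)%N = l -> tail i z -> fixed_by act glue_auts z ->
  gen_subfield glue_gens z.
Proof.
elim: d i z => [|d IH] i z.
  rewrite addn0 => -> tz Gz; apply: mem_gen; right.
  exact: tail_last.
rewrite addnS -addSn => iSd tz Gz; have il : (i < l)%N by rewrite -iSd leq_addr.
have SG u : tilde_block i u -> fixed_by act glue_auts u.
  by case=> j ij ->; apply: theta_f_fixed.
have sT : is_subfield (tail i.+1) by apply: varfieldP.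
have := fixed_gen_adjoin (frac_aut1 ge_basis) (frac_autM ge_basis) (G := glue_auts_group)
  sT (tail_stable il) SG (level_descent il tz Gz) Gz.
apply: gen_mono => u [[tu Gu]|bu]; first exact: IH tu Gu.
by apply: mem_gen; left; exists i.
Qed.

Lemma glue_fixedE z : fixed_by act glue_auts z <-> gen_subfield glue_gens z.
Proof.
split=> [Gz|]; last exact: glue_gens_fixed.
apply: (tail_fixed_gen (i := 0)) Gz; first exact: add0n.
by apply: varfield_sub (varfieldT z) => k _; rewrite /= /flag_rank big_geq.
Qed.

End Gluing.

Theorem theorem7p4
    (F : finFieldType) (n : nat) (W : vectType F) (hn : \dim {:W} = n)
    (l : nat) (Fl : nat -> {vspace W}) (hFl : is_flag l Fl)
    (e : n.-tuple W) (he : flag_basis l Fl e)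
    (G1 G2 : {pred 'End(W)})
    (hG1 : is_GL_subgroup G1) (hP1 : {subset G1 <= parabolic l Fl})
    (hG2 : is_GL_subgroup G2) (hP2 : {subset G2 <= parabolic l Fl})
    (f : 'I_n -> {mpoly F[n]})
    (hf_homog : forall j : 'I_n, homogeneous (f j))
    (hf_flag : flag_consistent l Fl f)
    (hf_gen : forall z : {fraction {mpoly F[n]}},
       inv_field e (fun g => g \in G1) (fun g : 'End(W) => g : W -> W) z <->
       gen_subfield (fun u => (exists c : F, u = tofrac c%:MP) \/
                              (exists j : 'I_n, u = tofrac (f j))) z) :
  forall z : {fraction {mpoly F[n + n]}},
    inv_field (glue_basis e) (gluing l Fl G1 G2) (@glue_act F W) z <->
    gen_subfield
      (fun u =>
         (exists (j : 'I_n) (p : {mpoly F[n + n]}),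
            is_tilde l Fl f j p /\ u = tofrac p) \/
         (exists2 v : {fraction {mpoly F[n]}},
            inv_field e (fun g => g \in G2) (fun g : 'End(W) => g : W -> W) v
            & u = embed2 v)) z.

Proof.
have e_basis : basis_of fullv e by case: he.
have hf_gen1 z : fixed_by (frac_aut e_basis) (End_auts G1) z <->
    gen_subfield (fgen f predT) z.
  rewrite -(End_inv_fieldE e_basis z hG1) hf_gen.
  split; apply: gen_mono => u [[c ->]|[j]].
  - by apply: mem_gen; left; exists c.
  - by move=> ->; apply: mem_gen; right; exists j.
  - by apply: mem_gen; left; exists c.
  - by move=> _ ->; apply: mem_gen; right; exists j.
move=> z; rewrite (glue_inv_fieldE l Fl hG1 hG2 e_basis).
rewrite (glue_fixedE hn hFl he hG1 hP1 hG2 hP2 (e_basis := e_basis) hf_flag hf_gen1).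
split; apply: gen_mono => u.
- case=> [[i [j ij ->]]|[v Gv ->]]; apply: mem_gen.
    left; exists j, (tilde_at Fl i (f j)); split; first by exists i.
    by rewrite (tilde_theta hf_flag ij).
  by right; exists v => //; apply/(End_inv_fieldE e_basis v hG2).
- case=> [[j [p [[i ij ->] ->]]]|[v Gv ->]]; apply: mem_gen.
    by left; exists i, j => //; rewrite (tilde_theta hf_flag ij).
  by right; exists v => //; apply/(End_inv_fieldE e_basis v hG2).
Qed.
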